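(* Let $p\ge5$ be a prime. For a given positive even integer $a_0$, there are only finitely many $(a_1,\ldots,a_{(p-1)/2})\in\mathbb{Z}^{(p-1)/2}$ such that $f_{a_0,\ldots,a_{(p-1)/2}}(\tau)$ is a modular form of weight $\frac{a_0}2$ for the subgroup $\Gamma_1(p)$.
   Context: Let $q=e^{2\pi i\tau}$, $(a;q)_\infty=\prod_{n\ge 1}(1-aq^{n-1})$, $(a,b;q)_\infty=(a;q)_\infty(b;q)_\infty$, $\langle r\rangle=r-\lfloor r\rfloor$. Put $$\ell(a_0,\ldots,a_{(p-1)/2})=\frac{p}{24}\Bigl(a_0+2\sum_{i=1}^{(p-1)/2}a_i\Bigr)-\frac p2\sum_{i=1}^{(p-1)/2}\Bigl\langle\frac ip\Bigr\rangle\Bigl(1-\Bigl\langle\frac ip\Bigr\rangle\Bigr)a_i,\qquad f_{a_0,\ldots,a_{(p-1)/2}}(\tau)=q^{\ell}(q^p;q^p)_\infty^{a_0}\prod_{i=1}^{(p-1)/2}(q^i,q^{p-i};q^p)_\infty^{a_i},$$ where $q^\ell=e^{2\pi i\ell\tau}$. Modular forms are holomorphic modular forms. *)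

(* Defs.v *)
From HB Require Import structures.
From mathcomp Require Import all_boot all_order all_algebra.
From mathcomp Require Import complex.
From mathcomp Require Import all_classical all_reals all_analysis.

Set Implicit Arguments.
Unset Strict Implicit.
Unset Printing Implicit Defensive.

Import Order.TTheory GRing.Theory Num.Theory.
Import numFieldNormedType.Exports.

Local Open Scope classical_set_scope.
Local Open Scope ring_scope.
Local Open Scope complex_scope.

(* [R[i]^o] is the field [R[i]] seen as a normed module over itself: limits are
   taken for the complex modulus and [derivable f z 1] is complex
   differentiability at [z]. *)
Notation cplx R := (R[i]^o).

Section Defs.
Variable R : realType.
Implicit Types (z tau a q : cplx R).

Definition cexp z : cplx R :=
  (expR (complex.Re z))%:C *
  (cos (complex.Im z) +i* sin (complex.Im z)).

(* [qpow l tau] is q^l = e^(2 pi i l tau) for a real exponent l; it depends on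
   tau and not only on the value of q. *)
Definition qpow (l : R) tau : cplx R := cexp ((2 * pi * l)%:C * 'i * tau).

Definition upper_half_plane : set (cplx R) := [set tau | 0 < complex.Im tau].

(* (a; q)_oo *)
Definition qpochhammer a q : cplx R :=
  limn (fun n : nat => \prod_(1 <= m < n.+1) (1 - a * q ^+ (m - 1)) : cplx R).

(* (a, b; q)_oo *)
Definition qpochhammer2 a b q : cplx R := qpochhammer a q * qpochhammer b q.

Definition fracpart (r : R) : R := r - (Num.floor r)%:~R.

(* The exponents (a_1, ..., a_((p-1)/2)) are indexed from 0: [a i] stands for
   a_(i+1). *)
Definition ell (p : nat) (a0 : int) (a : {ffun 'I_(p.-1)./2 -> int}) : R :=
  p%:R / 24 * (a0%:~R + 2 * \sum_(i < (p.-1)./2) (a i)%:~R)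
  - p%:R / 2 * \sum_(i < (p.-1)./2)
      fracpart (i.+1%:R / p%:R) * (1 - fracpart (i.+1%:R / p%:R)) * (a i)%:~R.

Definition eta_product (p : nat) (a0 : int) (a : {ffun 'I_(p.-1)./2 -> int})
    (tau : cplx R) : cplx R :=
  let q := qpow 1 tau in
  qpow (ell a0 a) tau * qpochhammer (q ^+ p) (q ^+ p) ^ a0 *
  \prod_(i < (p.-1)./2)
    qpochhammer2 (q ^+ i.+1) (q ^+ (p - i.+1)) (q ^+ p) ^ a i.

Definition SL2Z : set 'M[int]_2 := [set g | \det g = 1].

Definition Gamma1 (N : nat) : set 'M[int]_2 :=
  [set g | [/\ SL2Z g, (g 0%R 0%R = 1 %[mod N])%Z,
             (g 1%R 1%R = 1 %[mod N])%Z
             & (N %| g 1%R 0%R)%Z]].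

Definition automorphy (g : 'M[int]_2) tau : cplx R :=
  (g 1 0)%:~R * tau + (g 1 1)%:~R.

Definition moebius (g : 'M[int]_2) tau : cplx R :=
  ((g 0 0)%:~R * tau + (g 0 1)%:~R) / automorphy g tau.

Definition slash (k : int) (g : 'M[int]_2) (f : cplx R -> cplx R) tau : cplx R :=
  automorphy g tau ^ (- k) * f (moebius g tau).

(* Expansion in nonnegative powers of q_N = e^(2 pi i tau / N). *)
Definition holomorphic_at_infinity (N : nat) (f : cplx R -> cplx R) :=
  exists c : nat -> cplx R, forall tau, upper_half_plane tau ->
    series (fun n => c n * qpow N%:R^-1 tau ^+ n : cplx R) @ \oo --> f tau.

(* Holomorphy at every cusp is required through all the translates of f by
   SL_2(Z). Each translate is N-periodic, because Gamma(N) is normal in SL_2(Z)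
   and contained in Gamma_1(N); hence the common local parameter q_N. *)
Definition modular_form (N : nat) (k : int) (f : cplx R -> cplx R) :=
  [/\ forall tau, upper_half_plane tau -> derivable f tau 1,
      forall g, Gamma1 N g -> forall tau, upper_half_plane tau ->
        slash k g f tau = f tau
    & forall g, SL2Z g -> holomorphic_at_infinity N (slash k g f)].

End Defs.

(* Main.v *)
Require Import Defs.
From mathcomp Require Import all_boot all_order all_algebra.
From mathcomp Require Import complex.
From mathcomp Require Import all_classical all_reals all_analysis.
From mathcomp Require Import zify ring lra.

(** Write [V] for the Fourier transform on Z/p of the exponents: the even function
    [V n = a0 + 2 sum_i a_i cos (2 pi i n / p)].

    Orders at the cusps. Put [tau = l / p + i y] and [u = 2 pi y]. Expanding the
    logarithms of all the factors of the product gives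
    [u ln |f| --> - (1 / p) sum_m V (l m) / m^2] as [y] tends to [0]. Except for
    the factor [q^ell], which is negligible here, this is the Lambert series of
    [ln |f|] evaluated term by term, so no transformation formula of generalized
    eta functions is needed. Lemma [eta_product_log] is a version with explicit
    errors and with the series cut after [M] terms ([cusp_sum]).
    On the other hand, if [f] is a modular form, then its translate by a matrix
    sending infinity to [l / p] is bounded near infinity, so that [|f|] grows at
    most like a power of [1 / y] (lemma [cusp_growth]). Hence
    [E l = sum_m V (l m) / m^2 >= 0] for [l = 0, ..., p - 1]
    (lemma [modular_form_cusp_sum_ge]); these numbers are, up to positive factors,
    the orders of vanishing at the cusps [l / p].

    From orders to exponents. The transform of the exponents satisfies
    [sum_l V (l m) = p a0] for [m] prime to [p], so the sum of all the [E l] is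
    bounded in terms of [p], [a0] and [V 0]; since [E 0] is [V 0] times
    [sum_m 1 / m^2], nonnegativity bounds [V 0], and then every [E l], in terms of
    [p] and [a0] alone (lemmas [sum_cusp_sum_le] and [exponent_transform0_le]). As
    [sum_(m >= 2) 1 / m^2 < 1], the term [m = 1] of [E l] dominates the others
    where [|V|] is maximal, and [V] is bounded (lemma [exponent_transform_le]).
    Fourier inversion bounds the integers [a_i], which leaves finitely many
    families. *)

Local Open Scope classical_set_scope.
Local Open Scope ring_scope.
Import Order.TTheory GRing.Theory Num.Theory.
Import numFieldNormedType.Exports.

(** * The truncated logarithmic series *)
Section LogSeries.
Set Implicit Arguments.
Unset Strict Implicit.
Variable R : realType.
Implicit Types (x c th : R) (b : nat -> R).

Lemma nonneg_of_derive_ge0 (h dh : R -> R) x :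
  h 0 = 0 -> 0 <= x ->
  (forall y, 0 <= y <= x -> is_derive y 1 h (dh y)) ->
  (forall y, 0 <= y <= x -> 0 <= dh y) -> 0 <= h x.
Proof.
move=> h0 x0 hd dge0; rewrite -h0.
have inx y : y \in `]0, x[ -> 0 <= y <= x.
  by rewrite in_itv/= => /andP[y0 yx]; rewrite !ltW.
apply: (@ger0_derive1_ndecr _ _ 0 x) => //.
- by move=> y /inx /hd [].
- by move=> y /inx yi; have [_] := hd y yi; rewrite derive1E => ->; exact: dge0.
- by apply: derivable_within_continuous => y; rewrite in_itv/= => /hd [].
Qed.

(** Differentiating through [{poly R}] reduces the derivative of a concrete
    polynomial function to an algebraic identity. *)
Lemma is_derive_horner (P : {poly R}) (f : R -> R) d x :
  (forall y, f y = P.[y]) -> d = P^`().[x] -> is_derive x 1 f d.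
Proof. by move=> /funext -> ->; exact: is_derive_poly. Qed.

Lemma is_derive_powersum b M x :
  is_derive x 1 (fun y => \sum_(m < M) y ^+ m.+1 * (b m / m.+1%:R))
    (\sum_(m < M) x ^+ m * b m).
Proof.
pose P := \sum_(m < M) (b m / m.+1%:R) *: 'X^(m.+1) : {poly R}.
apply: (@is_derive_horner P) => [y|].
  rewrite horner_sum; apply: eq_bigr => m _.
  by rewrite hornerZ hornerXn mulrC.
rewrite raddf_sum horner_sum; apply: eq_bigr => m _.
rewrite [X in X.[_]]derivZ derivXn hornerZ hornerMn hornerXn -mulr_natr /=.
by field; rewrite lt0r_neq0// ltr0n.
Qed.

(** Real part of the geometric series of ratio [x e^(i th)], multiplied by
    [|1 - x e^(i th)|^2]. *)
Lemma cos_geometric_sum x th M :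
  (1 - 2 * x * cos th + x ^+ 2) * \sum_(m < M) x ^+ m * cos (m.+1%:R * th) =
  cos th - x - x ^+ M * (cos (M.+1%:R * th) - x * cos (M%:R * th)).
Proof.
elim: M => [|M IH]; first by rewrite big_ord0 expr0 mul0r cos0 !mul1r; ring.
rewrite big_ord_recr/= mulrDr IH.
have -> : M.+2%:R * th = M.+1%:R * th + th by rewrite -[M.+2]addn1 natrD; ring.
have -> : M%:R * th = M.+1%:R * th - th by rewrite -[M.+1]addn1 natrD; ring.
by rewrite !cosD cosN sinN (exprSr x M); ring.
Qed.

(** The left side is the real part of a unit vector times [x - e^(i th)], whose
    squared length is [D = |1 - x e^(i th)|^2]; moreover [sqrt D >= 1 - x]. *)
Lemma cos_geometric_tail x th M : 0 <= x < 1 ->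
  `|cos (M.+1%:R * th) - x * cos (M%:R * th)| <=
     (1 - 2 * x * cos th + x ^+ 2) / (1 - x).
Proof.
move=> /andP[x0 x1]; set D := _ + x ^+ 2.
have c1 := cos_le1 th.
have DE : (1 - x) ^+ 2 <= D by rewrite /D; nra.
have D0 : 0 < D by apply: lt_le_trans DE; rewrite exprn_gt0 ?subr_gt0.
rewrite ler_pdivlMr ?subr_gt0//.
have num2 : (cos (M.+1%:R * th) - x * cos (M%:R * th)) ^+ 2 <= D.
  have -> : M.+1%:R * th = M%:R * th + th by rewrite -[M.+1]addn1 natrD; ring.
  rewrite cosD; have := cos2Dsin2 (M%:R * th); have := cos2Dsin2 th.
  rewrite /D; set s := sin th; set c := cos th; set A := cos _; set B := sin _.
  move=> cs AB.
  have -> : 1 - 2 * x * c + x ^+ 2 = (A^+2 + B^+2) * ((x - c) ^+2 + s ^+2).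
    have s2 : s ^+ 2 = 1 - c ^+ 2 by rewrite -cs; ring.
    by rewrite AB mul1r s2; ring.
  (* Cauchy-Schwarz, with its defect as an explicit square. *)
  rewrite -subr_ge0 [leRHS](_ : _ = (B * (x - c) - A * s) ^+ 2) ?sqr_ge0//; ring.
rewrite -ler_sqr ?nnegrE; [|by rewrite mulr_ge0 ?subr_ge0 ?normr_ge0// ltW|exact: ltW].
by rewrite exprMn real_normK ?num_real// [X in _ <= X]expr2 ler_pM ?sqr_ge0.
Qed.

(** The tail, after [M] terms, of the series of [- ln (1 - x)]. Its derivative
    [x^M / (1 - x)] is what dominates the complex logarithmic series. *)
Definition log_remainder M x := - ln (1 - x) - \sum_(m < M) x ^+ m.+1 / m.+1%:R.

Lemma is_derive_log_remainder M x : x < 1 ->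
  is_derive x 1 (log_remainder M) (x ^+ M / (1 - x)).
Proof.
move=> x1; have h : 0 < 1 - x by rewrite subr_gt0.
have -> : log_remainder M = (fun y => - ln (1 - y)) \-
    (fun y => \sum_(m < M) y ^+ m.+1 * (1 / m.+1%:R)).
  apply/funext => y; rewrite /log_remainder/=; congr (_ - _).
  by apply: eq_bigr => i _; rewrite mul1r.
have H := @is_derive_powersum (fun=> 1) M x.
have H2 : is_derive x 1 (fun y => ln (1 - y)) (- (1 - x)^-1).
  have H3 : is_derive (1 - x) 1 (@ln R) (1 - x)^-1 by exact: is_derive1_ln.
  have H4 : is_derive x 1 (fun y : R => 1 - y) (-1).
    by apply: (@is_derive_horner (1 - 'X)) => [y|]; rewrite ?poly.derivE !hornerE ?sub0r.
  by have := @is_derive1_comp _ (@ln R) (fun y => 1 - y) x _ _ H3 H4; rewrite mulrN1.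
rewrite (_ : x ^+ M / (1 - x) = - - (1 - x)^-1 - \sum_(m < M) x ^+ m * 1).
  by apply: is_deriveB; exact: is_deriveN.
have -> : \sum_(m < M) x ^+ m * 1 = (1 - x ^+ M) / (1 - x).
  rewrite -(opprB (x ^+ M)) subrX1 -mulNr opprB mulrAC divff ?mul1r ?gt_eqF//.
  by apply: eq_bigr => i _; rewrite mulr1.
by field; rewrite gt_eqF.
Qed.

Lemma log_remainder0 M : log_remainder M 0 = 0.
Proof.
rewrite /log_remainder subr0 ln1 oppr0 big1 ?subr0// => i _.
by rewrite expr0n/= mul0r.
Qed.

(** With [z = x e^(i th)], the left side is the tail of [- ln |1 - z|], the real
    part of [sum_m z^m / m]. Both sides vanish at [x = 0], and the derivative of
    the left side is at most that of the right side in absolute value. *)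
Lemma log_norm_taylor x th M : 0 <= x < 1 ->
  `|ln (1 - 2 * x * cos th + x ^+ 2) / 2 +
    \sum_(m < M) x ^+ m.+1 * (cos (m.+1%:R * th) / m.+1%:R)| <= log_remainder M x.
Proof.
pose D (y : R) : R := 1 - 2 * y * cos th + y ^+ 2.
pose b (m : nat) : R := cos (m.+1%:R * th).
pose phi (y : R) : R := ln (D y) / 2 + \sum_(m < M) y ^+ m.+1 * (b m / m.+1%:R).
have D0 (y : R) : 0 <= y < 1 -> 0 < D y.
  move=> /andP[y0 y1]; apply: (@lt_le_trans _ _ ((1 - y) ^+ 2)).
    by rewrite exprn_gt0 ?subr_gt0.
  have c1 := cos_le1 th; rewrite /D; nra.
pose dphi (y : R) : R := (y - cos th) / D y + \sum_(m < M) y ^+ m * b m.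
have phid (y : R) : 0 <= y < 1 -> is_derive y 1 phi (dphi y).
  move=> yi; have Dy := D0 y yi.
  have H := is_derive_powersum b M y.
  have H3 : is_derive (D y) 1 (@ln R) (D y)^-1 by exact: is_derive1_ln.
  have H4 : is_derive y 1 D (2 * (y - cos th)).
    apply: (@is_derive_horner (1 - (2 * cos th) *: 'X + 'X^2)) => [z|];
      by rewrite /D ?poly.derivE !hornerE/=; ring.
  have H5 := is_derive1_comp H3 H4.
  have -> : phi = (fun y : R => 2^-1 *: (@ln R \o D) y) \+
      (fun y => \sum_(m < M) y ^+ m.+1 * (b m / m.+1%:R)).
    by apply/funext => z; rewrite /phi/= [ln _ / 2]mulrC.
  have -> : dphi y = 2^-1 *: ((D y)^-1 * (2 * (y - cos th))) + \sum_(m < M) y ^+ m * b m.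
    by rewrite /dphi /GRing.scale/=; congr (_ + _); field; rewrite gt_eqF.
  by apply: is_deriveD; exact: is_deriveZ.
have dphiE (y : R) : 0 <= y < 1 -> dphi y = - y ^+ M * ((b M - y * cos (M%:R * th)) / D y).
  move=> /D0 Dy; have := cos_geometric_sum y th M; rewrite -/(D y) => E.
  rewrite /dphi; have -> : \sum_(m < M) y ^+ m * b m = (D y * \sum_(m < M) y ^+ m * b m) / D y.
    by rewrite mulrAC divff ?mul1r// gt_eqF.
  by rewrite E /b; field; rewrite gt_eqF.
have dphi_le (y : R) : 0 <= y < 1 -> `|dphi y| <= y ^+ M / (1 - y).
  move=> yi; rewrite dphiE// normrM normrN; case/andP: (yi) => y0 y1.
  rewrite (ger0_norm (exprn_ge0 M y0)) ler_wpM2l ?exprn_ge0//.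
  rewrite normrM normfV (gtr0_norm (D0 _ yi)) ler_pdivrMr ?D0// [leRHS]mulrC.
  exact: cos_geometric_tail.
have phi0 : phi 0 = 0.
  rewrite /phi /D mulr0 mul0r subr0 expr0n/= addr0 ln1 mul0r add0r big1// => i _.
  by rewrite expr0n mul0r.
move=> xi; change (`|phi x| <= log_remainder M x).
have lex (y : R) : 0 <= y <= x -> 0 <= y < 1.
  by case/andP: xi => _ x1 /andP[-> yx]; rewrite (le_lt_trans yx).
case/andP: xi => x0 _.
rewrite ler_norml -subr_ge0 opprK; apply/andP; split.
  apply: (@nonneg_of_derive_ge0 (phi \+ log_remainder M)
    (fun y => dphi y + y ^+ M / (1 - y))) => //=.
  - by rewrite phi0 log_remainder0 addr0.
  - move=> y /lex yi; have := phid y yi; case/andP: yi => _ /(is_derive_log_remainder M) H1 H2.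
    exact: is_deriveD.
  - by move=> y /lex /dphi_le; rewrite ler_norml => /andP[h _]; rewrite -lerBlDr sub0r.
rewrite -subr_ge0.
apply: (@nonneg_of_derive_ge0 (log_remainder M \- phi)
  (fun y => y ^+ M / (1 - y) - dphi y)) => //=.
- by rewrite phi0 log_remainder0 subr0.
- move=> y /lex yi; have := phid y yi; case/andP: yi => _ /(is_derive_log_remainder M) H1 H2.
  exact: is_deriveB.
- by move=> y /lex /dphi_le; rewrite ler_norml subr_ge0 => /andP[_ h].
Qed.

(** For [0 <= y <= x] the derivative [y^M / (1 - y)] is at most [y^M / (1 - x)]. *)
Lemma log_remainder_le M x : 0 <= x < 1 ->
  log_remainder M x <= (M.+1%:R * (1 - x))^-1.
Proof.
move=> /andP[x0 x1].
have M0 : 0 < M.+1%:R * (1 - x) by rewrite mulr_gt0 ?subr_gt0.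
pose P := (M.+1%:R * (1 - x))^-1 *: 'X^(M.+1) : {poly R}.
suff : 0 <= (horner P \- log_remainder M) x.
  rewrite /= subr_ge0 => /le_trans; apply; rewrite hornerZ hornerXn.
  by rewrite ler_piMr ?invr_ge0 ?(ltW M0)// exprn_ile1// ltW.
have dP (y : R) : is_derive y 1 (horner P) P^`().[y] by exact: is_derive_poly.
apply: (@nonneg_of_derive_ge0 (horner P \- log_remainder M)
  (fun y => P^`().[y] - y ^+ M / (1 - y))).
- by rewrite /= log_remainder0 subr0 hornerZ hornerXn expr0n mulr0.
- by [].
- move=> y /andP[y0 yx]; apply: is_deriveB.
  by apply: is_derive_log_remainder; exact: le_lt_trans yx x1.
move=> y /andP[y0 yx].
have y1 : 0 < 1 - y by rewrite subr_gt0 (le_lt_trans yx).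
have -> : P^`().[y] = y ^+ M / (1 - x).
  rewrite /P derivZ derivXn hornerZ hornerMn hornerXn -mulr_natr.
  by field; rewrite !gt_eqF ?subr_gt0// ltr0n.
rewrite -mulrBr mulr_ge0 ?exprn_ge0// subr_ge0 lef_pV2 ?posrE ?subr_gt0//; lra.
Qed.

End LogSeries.

(** * Sums along arithmetic progressions of exponents *)
Section Sums.
Set Implicit Arguments.
Unset Strict Implicit.
Variable R : realType.
Implicit Types (u x y : R).

Lemma le_of_le_add_inv (A B C : R) : (forall n : nat, A <= B + C / n.+1%:R) -> A <= B.
Proof.
move=> H; rewrite leNgt; apply/negP => BA.
have C0 : 0 < C.
  have := H 0; rewrite divr1 => A1; lra.
have := H (Num.truncn (C / (A - B))); apply/negP.
rewrite -ltNge -ltrBrDl ltr_pdivrMr ?ltr0n// mulrC -ltr_pdivrMr ?subr_gt0//.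
exact: truncnS_gt.
Qed.

(** Telescoping: [1 / (k + 1)^2 <= 1 / k - 1 / (k + 1)]. *)
Lemma sum_inv_sqr_tail (M N : nat) : (0 < M)%N ->
  \sum_(m < N) ((M + m).+1%:R ^+ 2)^-1 <= M%:R^-1 :> R.
Proof.
move=> M0; apply: (@le_trans _ _ (M%:R^-1 - (M + N)%:R^-1)); last first.
  by rewrite gerBl invr_ge0.
elim: N => [|N IH]; first by rewrite big_ord0 addn0 subrr.
rewrite big_ord_recr/=.
have h0 : 0 < (M + N)%:R :> R by rewrite ltr0n addn_gt0 M0.
have h1 : 0 < (M + N)%:R + 1 :> R by rewrite addr_gt0.
suff : ((M + N).+1%:R ^+ 2)^-1 <= (M + N)%:R^-1 - (M + N.+1)%:R^-1 :> R.
  by move=> H; apply: le_trans (lerD IH H) _; rewrite addrA subrK.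
rewrite addnS -addn1 natrD -subr_ge0.
move: (M + N)%:R h0 h1 => k h0 h1.
rewrite (_ : _ - _ = (k * (k + 1) ^+ 2)^-1); last by field; rewrite !gt_eqF.
by rewrite invr_ge0 mulr_ge0 ?sqr_ge0 ?ltW.
Qed.

Lemma mul_expRN_le u : u * expR (- u) <= 1 - expR (- u).
Proof.
have := expR_ge1Dx u; have := expR_gt0 (- u).
have : expR u * expR (- u) = 1 by rewrite -expRD subrr expR0.
nra.
Qed.

Lemma one_sub_expRN_gt0 u : 0 < u -> 0 < 1 - expR (- u).
Proof. by move=> u0; rewrite subr_gt0 -expR0 ltr_expR oppr_lt0. Qed.

Lemma expRN_powE u (m : nat) : expR (- u) ^+ m = expR (- (m%:R * u)).
Proof. by rewrite -expRM_natl mulrN. Qed.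

(** The exponents are compared with [1, 2, 3, ...], and the geometric series of
    ratio [y = e^(- (m+1) u)] sums to [1 / (1/y - 1) <= 1 / ((m+1) u)]. *)
Lemma sum_progression_le u (j p m K : nat) : 0 < u -> (0 < j)%N -> (0 < p)%N ->
  \sum_(n < K) (expR (- u) ^+ (j + p * n)) ^+ m.+1 <= (u * m.+1%:R)^-1.
Proof.
move=> u0 j0 p0; set y := expR (- u) ^+ m.+1.
have yE : y = expR (- (m.+1%:R * u)) by rewrite /y expRN_powE.
have v0 : 0 < m.+1%:R * u by rewrite mulr_gt0.
have y0 : 0 < y by rewrite yE expR_gt0.
have y1 : 0 < 1 - y by rewrite yE one_sub_expRN_gt0.
have H : \sum_(n < K) (expR (- u) ^+ (j + p * n)) ^+ m.+1 <= y * \sum_(n < K) y ^+ n.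
  rewrite mulr_sumr; apply: ler_sum => n _.
  rewrite -exprS exprAC -/y ler_wiXn2l ?(ltW y0)//; first lra.
  by rewrite (leq_trans (_ : n.+1 <= j + n)%N) ?leq_add2l ?leq_pmull// -add1n leq_add2r.
apply: le_trans H _.
have G : (1 - y) * \sum_(n < K) y ^+ n = 1 - y ^+ K.
  by rewrite -(opprB y) mulNr -subrX1 opprB.
have yK : 0 <= y ^+ K by rewrite exprn_ge0 ?ltW.
have S : \sum_(n < K) y ^+ n <= (1 - y)^-1.
  by rewrite -[leRHS]div1r ler_pdivlMr// mulrC G; lra.
apply: le_trans (ler_wpM2l (ltW y0) S) _.
have := mul_expRN_le (m.+1%:R * u); rewrite -yE => E.
by rewrite ler_pdivrMr// -ler_pdivrMl ?invr_gt0 ?[u * _]mulrC// invrK.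
Qed.

(** This uniformity in [K] is what controls the product at a cusp. Bounding each
    remainder by [log_remainder_le] would cost a factor [ln (1 / u)]; instead the
    remainder is expanded further, up to order [M + N], summed over [n] before
    [m], and [N] is sent to infinity with [K] fixed. *)
Lemma sum_log_remainder_le u (j p M K : nat) : 0 < u -> (0 < j)%N -> (0 < p)%N ->
  (0 < M)%N ->
  \sum_(n < K) log_remainder M (expR (- u) ^+ (j + p * n)) <= (u * M%:R)^-1.
Proof.
move=> u0 j0 p0 M0.
pose x n := expR (- u) ^+ (j + p * n).
have x01 n : 0 <= x n < 1.
  have := one_sub_expRN_gt0 u0; rewrite subr_gt0 => r1.
  by rewrite /x exprn_ge0 ?expR_ge0//= exprn_ilt1 ?expR_ge0// addn_eq0 (gtn_eqF j0).
apply: (@le_of_le_add_inv _ _ (\sum_(n < K) (1 - x n)^-1)) => N.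
have step n : log_remainder M (x n) = log_remainder (M + N) (x n) +
    \sum_(m < N) x n ^+ (M + m).+1 / (M + m).+1%:R.
  by rewrite /log_remainder big_split_ord/=; ring.
under eq_bigr do rewrite -/(x _) step.
rewrite big_split/= addrC; apply: lerD.
  rewrite exchange_big/=; under eq_bigr do rewrite -mulr_suml.
  apply: (@le_trans _ _ (\sum_(m < N) u^-1 * ((M + m).+1%:R ^+ 2)^-1)).
    apply: ler_sum => m _.
    rewrite ler_pdivrMr ?ltr0n//; apply: le_trans (sum_progression_le _ _ u0 j0 p0) _.
    by rewrite expr2 !invfM -!mulrA mulVf ?pnatr_eq0// mulr1.
  rewrite -mulr_sumr invfM ler_wpM2l ?invr_ge0 ?(ltW u0)//; exact: sum_inv_sqr_tail.
rewrite mulr_suml; apply: ler_sum => n _.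
apply: le_trans (log_remainder_le _ (x01 n)) _; rewrite invfM mulrC.
have /andP[_ x1] := x01 n.
by rewrite ler_wpM2l ?invr_ge0 ?subr_ge0 ?(ltW x1)// lef_pV2 ?posrE ?ltr0n// ler_nat ltnS leq_addl.
Qed.

(** Residue at [v = 0] of the geometric sum of [e^(- v (j + p n))], with an error
    term valid for all [v]: with [w = p v], it follows from
    [1 - w <= e^(-w) <= 1 / (1 + w)]. *)
Lemma mul_geometric_approx (v : R) (j p : nat) : 0 < v -> (j <= p)%N -> (0 < p)%N ->
  `|v * (expR (- v) ^+ j / (1 - expR (- v) ^+ p)) - p%:R^-1| <= v.
Proof.
move=> v0 jp p0; rewrite !expRN_powE; set w := p%:R * v.
have w0 : 0 < w by rewrite mulr_gt0 ?ltr0n.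
have p0' : 0 < p%:R :> R by rewrite ltr0n.
have D0 := one_sub_expRN_gt0 w0.
set E := expR (- w) in D0 *; set F := expR (- (j%:R * v)).
have F1 : F <= 1 by rewrite /F -expR0 ler_expR oppr_le0 mulr_ge0// ltW.
have EF : E <= F by rewrite ler_expR lerN2 ler_pM2r// ler_nat.
have F0 : 0 <= F by exact: expR_ge0.
have E1 : 1 - w <= E by have := expR_ge1Dx (- w).
have E2 : w * E <= 1 - E := mul_expRN_le w.
have -> : v * (F / (1 - E)) - p%:R^-1 = p%:R^-1 * (w * F / (1 - E) - 1).
  by rewrite /w; field; rewrite !gt_eqF.
suff : `|w * F / (1 - E) - 1| <= w.
  rewrite normrM gtr0_norm ?invr_gt0// => H.
  by rewrite ler_pdivrMl// -/w.
rewrite ler_norml lerBlDr lerBrDr ler_pdivrMr// ler_pdivlMr//.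
have E0 : 0 < E by exact: expR_gt0.
by apply/andP; split; nra.
Qed.

End Sums.

(** * Convergence of q-Pochhammer products *)
Section ComplexLimits.
Set Implicit Arguments.
Unset Strict Implicit.
Variable R : realType.
Local Open Scope complex_scope.
Import Normc.

Definition cis (th : R) : R[i] := cos th +i* sin th.

Lemma cisD x y : cis (x + y) = cis x * cis y.
Proof. by rewrite /cis cosD sinD; simpc; congr (_ +i* _); ring. Qed.

Lemma cisX x n : cis x ^+ n = cis (n%:R * x).
Proof.
elim: n => [|n IH]; first by rewrite expr0 mul0r /cis cos0 sin0.
by rewrite exprS IH -cisD -[n.+1]add1n natrD mulrDl mul1r.
Qed.

Lemma normc_cis x : normc (cis x) = 1.
Proof. by rewrite /cis /= cos2Dsin2 sqrtr1. Qed.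

Lemma normc_real (x : R) : normc x%:C = `|x|.
Proof. by rewrite /= expr0n/= addr0 sqrtr_sqr. Qed.

Lemma normc_ge0 (z : R[i]) : 0 <= normc z.
Proof. by case: z => x y; exact: sqrtr_ge0. Qed.

Lemma norm_cplxE (z : cplx R) : `|z| = (normc z)%:C.
Proof. by case: z. Qed.

Lemma normcX (z : R[i]) n : normc (z ^+ n) = normc z ^+ n.
Proof. by elim: n => [|n IH]; rewrite ?normc1// !exprS normcM IH. Qed.

Lemma cvg_normc (z : nat -> R[i]^o) (l : R[i]^o) :
  z @ \oo --> l -> (fun n => normc (z n)) @ \oo --> normc l.
Proof.
move=> /cvg_norm /cvgrPdist_lt zl; apply/cvgrPdist_lt => e e0.
have := zl e%:C; rewrite ltcR => /(_ e0); apply: filterS => n.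
move=> h; have : (normc (`|l| - `|z n|))%:C < e%:C by exact: h.
by rewrite !norm_cplxE -rmorphB ltcR normc_real.
Qed.

Lemma cvg_complex (z : nat -> R[i]^o) (x y : R) :
  (fun n => complex.Re (z n)) @ \oo --> x -> (fun n => complex.Im (z n)) @ \oo --> y ->
  z @ \oo --> (x +i* y : R[i]^o).
Proof.
move=> /cvgrPdist_lt zx /cvgrPdist_lt zy; apply/cvgrPdist_lt => e.
case: e => e e'; rewrite ltcE/= => /andP[/eqP -> e0].
have e20 : 0 < e / 2 by rewrite divr_gt0.
have := zx _ e20; have := zy _ e20; apply: filterS2 => n Hy Hx.
rewrite norm_cplxE ltcR; case: (z n) Hx Hy => a b /= Hx Hy.
change (normc ((x - a) +i* (y - b)) < e).
have -> : (x - a) +i* (y - b) = (x - a)%:C + (y - b)%:C * 'i%C by simpc.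
apply: le_lt_trans (le_normcD _ _) _; rewrite normcM !normc_real.
by rewrite /= expr0n expr1n add0r sqrtr1 mulr1; lra.
Qed.

Lemma normc_Re (z : R[i]) : `|complex.Re z| <= normc z.
Proof. by case: z => x y; rewrite /= -sqrtr_sqr ler_wsqrtr// lerDl sqr_ge0. Qed.

Lemma normc_Im (z : R[i]) : `|complex.Im z| <= normc z.
Proof. by case: z => x y; rewrite /= -sqrtr_sqr ler_wsqrtr// lerDr sqr_ge0. Qed.

Lemma cvg_geometric_increments (x : nat -> R) (B r : R) : `|r| < 1 ->
  (forall n, `|x n.+1 - x n| <= B * r ^+ n) -> cvgn x.
Proof.
move=> r1 H.
have E : x = (fun n => x 0 + series (fun n => x n.+1 - x n) n).
  apply/funext => n; rewrite /series/= telescope_sumr //; ring.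
rewrite E; apply: is_cvgD; first exact: is_cvg_cst.
apply: normed_cvg; apply: (@series_le_cvg _ _ (geometric B r)) => //.
- by move=> n /=.
- by move=> n; apply: le_trans (H n).
exact: is_cvg_geometric_series.
Qed.

Definition pochhammer_prod (a q : cplx R) (n : nat) : cplx R := \prod_(j < n) (1 - a * q ^+ j).

Lemma normc_pochhammer_prod_le (a q : cplx R) n : normc q < 1 ->
  normc (pochhammer_prod a q n) <= expR (normc a / (1 - normc q)).
Proof.
move=> q1; have q0 : 0 <= normc q by exact: normc_ge0.
have a0 : 0 <= normc a by exact: normc_ge0.
apply: (@le_trans _ _ (expR (\sum_(j < n) normc a * normc q ^+ j))).
  elim: n => [|n IH]; first by rewrite /pochhammer_prod !big_ord0 normc1 expR0.
  rewrite /pochhammer_prod !big_ord_recr/= normcM expRD ler_pM ?normc_ge0//.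
  apply: le_trans (le_normcD _ _) _.
  rewrite normc1 normcN normcM normcX; exact: expR_ge1Dx.
rewrite ler_expR -mulr_sumr ler_wpM2l //.
rewrite -[leRHS]div1r ler_pdivlMr ?subr_gt0// mulrC -opprB mulNr -subrX1 opprB.
by rewrite gerBl exprn_ge0.
Qed.

(** The factors are [1 + O(|q|^n)], so the bounded partial products have
    geometrically small increments; convergence is checked on real and imaginary
    parts. *)
Lemma qpochhammer_cvg (a q : cplx R) : normc q < 1 ->
  pochhammer_prod a q @ \oo --> qpochhammer a q.
Proof.
move=> q1; have q0 : 0 <= normc q by exact: normc_ge0.
have E : (fun n : nat => \prod_(1 <= m < n.+1) (1 - a * q ^+ (m - 1)) : cplx R) =
    pochhammer_prod a q.
  apply/funext => n; rewrite big_add1/= big_mkord; apply: eq_bigr => j _.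
  by rewrite subn1.
rewrite /qpochhammer E.
set P := pochhammer_prod a q; set B := expR (normc a / (1 - normc q)).
have inc n : normc (P n.+1 - P n) <= B * normc a * normc q ^+ n.
  rewrite /P /pochhammer_prod big_ord_recr/= mulrBr mulr1 addrAC subrr add0r.
  rewrite normcN !normcM normcX mulrA ler_wpM2r ?exprn_ge0// ler_wpM2r//.
    exact: normc_ge0.
  exact: normc_pochhammer_prod_le.
have q1' : `|normc q| < 1 by rewrite ger0_norm.
have [x Hx] : exists x : R, (fun n => complex.Re (P n) : R) @ \oo --> x.
  apply/(@cvg_ex R^o); apply: (cvg_geometric_increments (B := B * normc a) q1') => n.
  by apply: le_trans (inc n); rewrite -raddfB; exact: normc_Re.
have [y Hy] : exists y : R, (fun n => complex.Im (P n) : R) @ \oo --> y.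
  apply/(@cvg_ex R^o); apply: (cvg_geometric_increments (B := B * normc a) q1') => n.
  by apply: le_trans (inc n); rewrite -raddfB; exact: normc_Im.
exact: (cvgP _ (cvg_complex Hx Hy)).
Qed.

End ComplexLimits.

(** * Size of a q-Pochhammer product near a root of unity *)
Section PochhammerLog.
Set Implicit Arguments.
Unset Strict Implicit.
Variable R : realType.
Local Open Scope complex_scope.
Import Normc.

Lemma normc_one_sub_sqr (x th : R) :
  normc (1 - x%:C * cis th) ^+ 2 = 1 - 2 * x * cos th + x ^+ 2.
Proof.
have -> : 1 - x%:C * cis th = (1 - x * cos th) +i* (- (x * sin th)) by rewrite /cis; simpc.
rewrite /= sqr_sqrtr ?addr_ge0 ?sqr_ge0//.
have s2 : sin th ^+ 2 = 1 - cos th ^+ 2 by rewrite -(cos2Dsin2 th); ring.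
by rewrite sqrrN exprMn s2; ring.
Qed.

Lemma ln_normc_one_sub (x th : R) : 0 <= x < 1 -> 0 < normc (1 - x%:C * cis th) /\
  ln (normc (1 - x%:C * cis th)) = ln (1 - 2 * x * cos th + x ^+ 2) / 2.
Proof.
move=> /andP[x0 x1]; have := normc_one_sub_sqr x th.
set N := normc _ => NE.
have N0 : 0 < N.
  rewrite lt_def normc_ge0 andbT; apply/eqP => N0.
  have := cos_le1 th; move: NE; rewrite N0 expr0n/= => NE c1.
  have : 0 < (1 - x) ^+ 2 by rewrite exprn_gt0// subr_gt0.
  have : 0 <= 2 * x * (1 - cos th) by rewrite !mulr_ge0// subr_ge0.
  nra.
by split => //; rewrite -NE lnXn//; field.
Qed.

(** Take logarithms in the finite product, expand every factor to order [M] by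
    [log_norm_taylor], and exchange the two sums. *)
Lemma pochhammer_prod_log (u th : R) (j p M K : nat) :
  0 < u -> (0 < j)%N -> (0 < p)%N -> (0 < M)%N ->
  let a : cplx R := (expR (- u) ^+ j)%:C * cis th in
  let N := normc (pochhammer_prod a (expR (- u) ^+ p)%:C K) in
  0 < N /\
  `|ln N + \sum_(m < M) cos (m.+1%:R * th) / m.+1%:R *
        \sum_(n < K) (expR (- u) ^+ (j + p * n)) ^+ m.+1| <= (u * M%:R)^-1.
Proof.
move=> u0 j0 p0 M0 a; set r := expR (- u) in a *.
have r1 : r < 1 by have := one_sub_expRN_gt0 u0; rewrite subr_gt0.
have r0 : 0 <= r by exact: expR_ge0.
pose x n := r ^+ (j + p * n).
have x01 n : 0 <= x n < 1.
  by rewrite /x exprn_ge0//= exprn_ilt1 ?expR_ge0// addn_eq0 (gtn_eqF j0).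
have factor n : 1 - a * (r ^+ p)%:C ^+ n = 1 - (x n)%:C * cis th.
  have -> : (x n)%:C = (r ^+ j)%:C * (r ^+ p)%:C ^+ n :> R[i].
    by rewrite -rmorphXn -rmorphM /x exprD exprM.
  by rewrite /a [RHS]/= mulrAC.
have NE k : 0 < normc (pochhammer_prod a (r ^+ p)%:C k) /\
    ln (normc (pochhammer_prod a (r ^+ p)%:C k)) =
    \sum_(n < k) ln (1 - 2 * x n * cos th + x n ^+ 2) / 2.
  elim: k => [|k [IH0 IH]]; first by rewrite /pochhammer_prod !big_ord0 normc1 ln1.
  rewrite /pochhammer_prod !big_ord_recr/= normcM factor.
  have [f0 f1] := ln_normc_one_sub th (x01 k).
  by split; rewrite ?mulr_gt0// lnM ?posrE// f1 -IH.
move=> N; have [N0 lnN] := NE K; split => //.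
rewrite /N lnN.
under [X in _ + X]eq_bigr do rewrite mulr_sumr.
rewrite exchange_big -big_split/=.
apply: le_trans (ler_norm_sum _ _ _) _.
apply: le_trans (sum_log_remainder_le K u0 j0 p0 M0).
apply: ler_sum => n _.
apply: le_trans (log_norm_taylor th M (x01 n)); rewrite le_eqVlt; apply/orP; left; apply/eqP.
by congr `|_ + _|; apply: eq_bigr => m _; rewrite mulrC.
Qed.

Lemma cvg_pochhammer_sums (u th : R) (j p M : nat) :
  0 < u -> (0 < p)%N ->
  (fun K => \sum_(m < M) cos (m.+1%:R * th) / m.+1%:R *
        \sum_(n < K) (expR (- u) ^+ (j + p * n)) ^+ m.+1) @ \oo -->
  \sum_(m < M) cos (m.+1%:R * th) / m.+1%:R *
     (expR (- (m.+1%:R * u)) ^+ j / (1 - expR (- (m.+1%:R * u)) ^+ p)).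
Proof.
move=> u0 p0.
elim: M => [|M IH].
  rewrite big_ord0; under eq_fun do rewrite big_ord0; exact: cvg_cst.
rewrite big_ord_recr/=; under eq_fun do rewrite big_ord_recr/=.
apply: cvgD => //; apply: cvgMr.
set y := expR (- (M.+1%:R * u)).
have yp : `|y ^+ p| < 1.
  rewrite ger0_norm ?exprn_ge0 ?expR_ge0// exprn_ilt1 ?expR_ge0// ?(gtn_eqF p0)//.
  by rewrite -subr_gt0 one_sub_expRN_gt0// mulr_gt0.
have := @cvg_geometric_series _ (y ^+ j) _ yp; apply: cvg_trans.
apply: near_eq_cvg; near=> K; rewrite /series/= big_mkord; apply: eq_bigr => n _.
by rewrite exprAC expRN_powE -/y exprD exprM.
Unshelve. all: by end_near. Qed.

(** The first-order behaviour as [u] tends to [0]: [- ln |(a; Q)_oo|] is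
    [sum_m cos (m th) / m * e^(- j m u) / (1 - e^(- p m u))], and the [m]-th term
    times [u] tends to [cos (m th) / (p m^2)]. Cutting the series at [M] costs
    [1 / M], replacing the [M] first terms by their limits costs [u M]. The limit
    value is real dilogarithm data; only its Fourier expansion is needed. *)
Lemma qpochhammer_log (u th : R) (j p M : nat) :
  0 < u -> (0 < j <= p)%N -> (0 < M)%N ->
  let N := normc (qpochhammer ((expR (- u) ^+ j)%:C * cis th) (expR (- u) ^+ p)%:C) in
  0 < N /\
  `|u * ln N + p%:R^-1 * \sum_(m < M) cos (m.+1%:R * th) / m.+1%:R ^+ 2|
     <= M%:R^-1 + u * M%:R.
Proof.
move=> u0 /andP[j0 jp] M0; have p0 := leq_trans j0 jp.
set a : cplx R := _ * cis th; set Q : cplx R := (expR _ ^+ p)%:C => N.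
have r1 : expR (- u) < 1 by have := one_sub_expRN_gt0 u0; rewrite subr_gt0.
have Q1 : normc Q < 1.
  by rewrite normc_real ger0_norm ?exprn_ge0 ?expR_ge0// exprn_ilt1 ?expR_ge0// gtn_eqF.
have cN : (fun K => normc (pochhammer_prod a Q K)) @ \oo --> N.
  by apply: cvg_normc; exact: qpochhammer_cvg.
have cS := @cvg_pochhammer_sums u th j p M u0 p0.
set S := (fun _ => _) in cS; set s := (X in _ --> X) in cS.
set d := (u * M%:R)^-1.
have bnd K : 0 < normc (pochhammer_prod a Q K) /\
    `|ln (normc (pochhammer_prod a Q K)) + S K| <= d.
  exact: pochhammer_prod_log.
have lower : expR (- s - d) <= N.
  apply: (ler_cvg_to _ cN).
    apply: continuous_cvg; first exact: continuous_expR.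
    by apply: cvgB; [apply: cvgN; exact: cS|exact: cvg_cst].
  near=> K; have [N0 NK] := bnd K; rewrite -[leRHS]lnK// ler_expR.
  change (- S K - d <= ln (normc (pochhammer_prod a Q K))).
  by move: NK; rewrite ler_norml => /andP[+ _]; lra.
have upper : N <= expR (- s + d).
  apply: (ler_cvg_to cN).
    apply: continuous_cvg; first exact: continuous_expR.
    by apply: cvgD; [apply: cvgN; exact: cS|exact: cvg_cst].
  near=> K; have [N0 NK] := bnd K; rewrite -[leLHS]lnK// ler_expR.
  change (ln (normc (pochhammer_prod a Q K)) <= - S K + d).
  by move: NK; rewrite ler_norml => /andP[_ +]; lra.
have N0 : 0 < N by apply: lt_le_trans lower; exact: expR_gt0.
split => //.
have lnN : `|ln N + s| <= d.
  move: lower upper; rewrite -{1 2}[N]lnK// !ler_expR ler_norml => lo up.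
  by apply/andP; split; lra.
have p0' : 0 < p%:R :> R by rewrite ltr0n.
have near_s : `|u * s - p%:R^-1 * \sum_(m < M) cos (m.+1%:R * th) / m.+1%:R ^+ 2| <= u * M%:R.
  rewrite /s mulr_sumr [p%:R^-1 * _]mulr_sumr -sumrB.
  apply: le_trans (ler_norm_sum _ _ _) _.
  apply: (@le_trans _ _ (\sum_(m < M) u)); last by rewrite sumr_const card_ord mulr_natr.
  apply: ler_sum => m _.
  have m0 : 0 < m.+1%:R :> R by rewrite ltr0n.
  have := mul_geometric_approx (mulr_gt0 m0 u0) jp p0.
  set G := _ ^+ j / _ => HG.
  have -> : u * (cos (m.+1%:R * th) / m.+1%:R * G) -
      p%:R^-1 * (cos (m.+1%:R * th) / m.+1%:R ^+ 2) =
     cos (m.+1%:R * th) * (m.+1%:R ^+ 2)^-1 * (m.+1%:R * u * G - p%:R^-1).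
    by move: m.+1%:R m0 p%:R p0' G {HG} (cos _) => k k0 P P0 G C; field; rewrite !gt_eqF.
  rewrite !normrM [X in _ * X * _]gtr0_norm ?invr_gt0 ?exprn_gt0//.
  have C1 : `|cos (m.+1%:R * th)| <= 1 by rewrite ler_norml cos_geN1 cos_le1.
  apply: (@le_trans _ _ (1 * (m.+1%:R ^+ 2)^-1 * (m.+1%:R * u))).
    have i0 : 0 <= (m.+1%:R ^+ 2)^-1 :> R by rewrite invr_ge0 exprn_ge0 ?ltW.
    by apply: ler_pM => //; exact: ler_wpM2r.
  rewrite mul1r mulrA ler_piMl ?(ltW u0)// expr2 invfM -mulrA mulVf ?gt_eqF// mulr1.
  by rewrite invf_le1// ler1n.
have near_N : `|u * ln N + u * s| <= M%:R^-1.
  rewrite -mulrDr normrM gtr0_norm// mulrC -ler_pdivlMr//.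
  by rewrite -invfM mulrC.
rewrite [X in `|X|](_ : _ = (u * ln N + u * s) -
  (u * s - p%:R^-1 * \sum_(m < M) cos (m.+1%:R * th) / m.+1%:R ^+ 2)); last ring.
by apply: le_trans (ler_normB _ _) _; exact: lerD.
Unshelve. all: by end_near. Qed.

End PochhammerLog.

(** * Size of the eta product near a rational point *)
Section EtaLog.
Set Implicit Arguments.
Unset Strict Implicit.
Variable R : realType.
Local Open Scope complex_scope.
Import Normc.

Lemma qpowE (l x y : R) :
  qpow l (x +i* y) = (expR (- (2 * pi * l * y)))%:C * cis (2 * pi * l * x).
Proof.
rewrite /qpow /cexp.
have -> : ((2 * pi * l)%:C * 'i * (x +i* y) : R[i]) = (- (2 * pi * l * y)) +i* (2 * pi * l * x).
  by simpc.
by [].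
Qed.

Lemma normc_qpow (l x y : R) : normc (qpow l (x +i* y)) = expR (- (2 * pi * l * y)).
Proof. by rewrite qpowE normcM normc_cis mulr1 normc_real ger0_norm ?expR_ge0. Qed.

Definition cosp (p n : nat) : R := cos (2 * pi * (n%:R / p%:R)).

Lemma cos_sub_nat2pi (n : nat) (x : R) : cos (n%:R * (2 * pi) - x) = cos x.
Proof.
elim: n => [|n IH]; first by rewrite mul0r sub0r cosN.
have -> : n.+1%:R * (2 * pi) - x = (n%:R * (2 * pi) - x) + pi *+ 2 :> R.
  by rewrite -addn1 natrD -mulr_natr; ring.
by rewrite cosD2pi.
Qed.

(** [cosp p] depends on its argument only modulo [p] and up to sign. *)
Lemma cosp_reflect (p n n' k : nat) : (0 < p)%N -> (n + n' = p * k)%N -> cosp p n = cosp p n'.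
Proof.
move=> p0 E; rewrite /cosp -(cos_sub_nat2pi k (2 * pi * (n'%:R / p%:R))); congr cos.
have : n%:R + n'%:R = p%:R * k%:R :> R by rewrite -natrD E natrM.
move/(canRL (addrK _)) => ->; field.
by rewrite pnatr_eq0 gtn_eqF.
Qed.

Lemma cosp_mul (p k : nat) : (0 < p)%N -> cosp p (p * k) = 1.
Proof.
move=> p0; rewrite (@cosp_reflect p (p * k) 0 k) ?addn0//.
by rewrite /cosp mul0r mulr0 cos0.
Qed.

Lemma cis_nat2pi (n : nat) : cis (n%:R * (2 * pi)) = 1 :> R[i].
Proof.
rewrite -cisX (_ : cis _ = 1) ?expr1n// /cis.
have -> : 2 * pi = 0 + pi *+ 2 :> R by ring.
by rewrite cosD2pi sinD2pi cos0 sin0.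
Qed.

(** At [tau = l / p + i y] the power [q^p] is real, and [qpochhammer_log] applies
    with [u = 2 pi y] and [th = 2 pi l j / p]. *)
Lemma qpochhammer_qpow_log (p l j M : nat) (y : R) : (0 < p)%N -> 0 < y ->
  (0 < j <= p)%N -> (0 < M)%N ->
  let q := qpow 1 ((l%:R / p%:R) +i* y) in
  let N := normc (qpochhammer (q ^+ j) (q ^+ p)) in
  0 < N /\
  `|2 * pi * y * ln N + p%:R^-1 * \sum_(m < M) cosp p (l * m.+1 * j) / m.+1%:R ^+ 2|
     <= M%:R^-1 + 2 * pi * y * M%:R.
Proof.
move=> p0 y0 jp M0 q.
have u0 : 0 < 2 * pi * y by rewrite !mulr_gt0// pi_gt0.
have qX k : q ^+ k =
    (expR (- (2 * pi * y)) ^+ k)%:C * cis (k%:R * (2 * pi * (l%:R / p%:R))) :> R[i].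
  by rewrite /q qpowE !mulr1 exprMn -rmorphXn/= cisX.
have p0' : p%:R != 0 :> R by rewrite pnatr_eq0 gtn_eqF.
have qp : q ^+ p = (expR (- (2 * pi * y)) ^+ p)%:C :> R[i].
  rewrite qX (_ : p%:R * _ = l%:R * (2 * pi)); last by field.
  by rewrite cis_nat2pi mulr1.
have := qpochhammer_log (j%:R * (2 * pi * (l%:R / p%:R))) u0 jp M0.
rewrite -qX -qp => -[N0 H]; split => //.
congr (is_true (`|_ + _ * _| <= _)) : H; apply: eq_bigr => m _; congr (_ / _).
rewrite /cosp; congr cos; rewrite !natrM; ring.
Qed.

(** The Fourier transform on Z/p of the even function with value [a0] at [0] and
    [a_i] at [i] and [- i]. *)
Definition exponent_transform (p : nat) (a0 : int) (a : {ffun 'I_(p.-1)./2 -> int}) (n : nat) : R :=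
  a0%:~R + 2 * \sum_(i < (p.-1)./2) (a i)%:~R * cosp p (n * i.+1).

(** Up to a positive factor, the limit of this sum as [M] tends to infinity is the
    order of vanishing of the eta product at the cusp [l / p], for [p] prime and
    [l < p]. *)
Definition cusp_sum (p : nat) (a0 : int) (a : {ffun 'I_(p.-1)./2 -> int})
    (l M : nat) : R :=
  \sum_(m < M) exponent_transform a0 a (l * m.+1) / m.+1%:R ^+ 2.

Definition exponent_norm (p : nat) (a0 : int) (a : {ffun 'I_(p.-1)./2 -> int}) : R :=
  `|a0%:~R| + 2 * \sum_(i < (p.-1)./2) `|(a i)%:~R|.

Lemma normcXz (z : R[i]) (n : int) : normc (z ^ n) = normc z ^ n.
Proof. by case: n => n; rewrite /exprz ?normcV normcX. Qed.

Lemma ln_exprz (x : R) (n : int) : 0 < x -> ln (x ^ n) = n%:~R * ln x.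
Proof.
move=> x0; case: n => n; rewrite /exprz; first by rewrite lnXn// mulr_natl.
rewrite lnV ?posrE ?exprn_gt0// lnXn// NegzE rmorphN/= mulNr; congr (- _).
by rewrite mulr_natl.
Qed.

Lemma normc_prod (I : Type) (s : seq I) (F : I -> R[i]) :
  normc (\prod_(i <- s) F i) = \prod_(i <- s) normc (F i).
Proof. by elim/big_rec2: _ => [|i x y _ <-]; rewrite ?normc1 ?normcM. Qed.

Lemma ln_prod (I : Type) (s : seq I) (F : I -> R) : (forall i, 0 < F i) ->
  ln (\prod_(i <- s) F i) = \sum_(i <- s) ln (F i).
Proof.
move=> F0; elim: s => [|i s IH]; first by rewrite !big_nil ln1.
by rewrite !big_cons lnM ?posrE ?prodr_gt0// IH.
Qed.

(** All [p] residues [j] contribute through [qpochhammer_qpow_log]; the residues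
    [i] and [p - i] contribute equally. The factor [q^ell] only produces a term of
    order [u^2]. *)
Lemma eta_product_log (p l M : nat) (a0 : int) (a : {ffun 'I_(p.-1)./2 -> int}) (y : R) :
  (0 < p)%N -> 0 < y -> (0 < M)%N ->
  let u := 2 * pi * y in
  let N := normc (eta_product a0 a ((l%:R / p%:R) +i* y)) in
  0 < N /\
  `|u * ln N + u ^+ 2 * ell R a0 a +
     p%:R^-1 * cusp_sum a0 a l M|
     <= exponent_norm a0 a * (M%:R^-1 + u * M%:R).
Proof.
move=> p0 y0 M0 u.
set d := M%:R^-1 + u * M%:R; set tau := _ +i* y.
set q := qpow 1 tau.
pose N j := normc (qpochhammer (q ^+ j) (q ^+ p)).
pose T j := p%:R^-1 * \sum_(m < M) cosp p (l * m.+1 * j) / m.+1%:R ^+ 2.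
have H j : (0 < j <= p)%N -> 0 < N j /\ `|u * ln (N j) + T j| <= d.
  by move=> jp; exact: qpochhammer_qpow_log.
have ip (i : 'I_(p.-1)./2) : (0 < i.+1 <= p)%N.
  have := ltn_ord i; move: (nat_of_ord i) => k; rewrite -divn2 => /leq_trans/(_ (leq_div _ _)) kp.
  by rewrite /= (leq_trans kp)// leq_pred.
have ip' (i : 'I_(p.-1)./2) : (0 < p - i.+1 <= p)%N.
  rewrite leq_subr andbT subn_gt0.
  have := ltn_ord i; move: (nat_of_ord i) => k; rewrite -divn2 => /leq_trans/(_ (leq_div _ _)) kp.
  by rewrite -(prednK p0) ltnS.
have pp : (0 < p <= p)%N by rewrite p0 leqnn.
have [Np0 HNp] := H _ pp.
have NE : normc (eta_product a0 a tau) = expR (- (u * ell R a0 a)) * N p ^ a0 *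
    \prod_(i < (p.-1)./2) (N i.+1 * N (p - i.+1)%N) ^ a i.
  rewrite /eta_product -/q 2!normcM normcXz normc_prod; congr (_ * _ * _).
    rewrite /tau normc_qpow.
    by congr (expR (- _)); rewrite /u; ring.
  by apply: eq_bigr => i _; rewrite normcXz normcM.
have P0 (i : 'I_(p.-1)./2) : 0 < (N i.+1 * N (p - i.+1)%N) ^ a i.
  have [n0 _] := H _ (ip i); have [n1 _] := H _ (ip' i).
  by rewrite exprz_gt0// mulr_gt0.
have Q0 : 0 < \prod_(i < (p.-1)./2) (N i.+1 * N (p - i.+1)%N) ^ a i.
  by apply: prodr_gt0.
rewrite NE; split; first by rewrite !mulr_gt0 ?expR_gt0 ?exprz_gt0.
rewrite !lnM ?posrE ?mulr_gt0 ?expR_gt0 ?exprz_gt0// expRK ln_exprz// ln_prod//.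
have -> : \sum_(i < (p.-1)./2) ln ((N i.+1 * N (p - i.+1)%N) ^ a i) =
   \sum_(i < (p.-1)./2) (a i)%:~R * (ln (N i.+1) + ln (N (p - i.+1)%N)).
  apply: eq_bigr => i _; have [n0 _] := H _ (ip i); have [n1 _] := H _ (ip' i).
  by rewrite ln_exprz ?mulr_gt0// lnM.
have -> : p%:R^-1 * cusp_sum a0 a l M =
    a0%:~R * T p + \sum_(i < (p.-1)./2) (a i)%:~R * (T i.+1 + T (p - i.+1)%N).
  have T' (i : 'I_(p.-1)./2) : T (p - i.+1)%N = T i.+1.
    rewrite /T; congr (_ * _); apply: eq_bigr => m _; congr (_ / _).
    have e : (p - i.+1 + i.+1)%N = p by rewrite subnK//; case/andP: (ip i).
    apply: (@cosp_reflect _ _ _ (l * m.+1)%N p0).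
    by rewrite -mulnDr e mulnC.
  under [X in _ = _ + X]eq_bigr do rewrite T' -mulr2n -mulr_natl mulrCA.
  rewrite -mulr_sumr /T /cusp_sum.
  under [X in _ = _ + _ * X]eq_bigr do rewrite mulrCA mulr_sumr.
  rewrite -mulr_sumr exchange_big/= [2 * _]mulrCA [a0%:~R * _]mulrCA -mulrDr; congr (_ * _).
  rewrite !mulr_sumr -big_split/=; apply: eq_bigr => m _.
  have -> : cosp p (l * m.+1 * p) = 1 by rewrite mulnC cosp_mul.
  rewrite /exponent_transform mulrDl mul1r; congr (_ + _).
  by rewrite -mulrA mulr_suml; congr (_ * _); apply: eq_bigr => i _; rewrite mulrA.
rewrite [X in `|X|](_ : _ = a0%:~R * (u * ln (N p) + T p) + \sum_(i < (p.-1)./2)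
    (a i)%:~R * ((u * ln (N i.+1) + T i.+1) + (u * ln (N (p - i.+1)%N) + T (p - i.+1)%N))); last first.
  have -> : \sum_(i < (p.-1)./2)
    (a i)%:~R * ((u * ln (N i.+1) + T i.+1) + (u * ln (N (p - i.+1)%N) + T (p - i.+1)%N)) =
    u * (\sum_(i < (p.-1)./2) (a i)%:~R * (ln (N i.+1) + ln (N (p - i.+1)%N))) +
    \sum_(i < (p.-1)./2) (a i)%:~R * (T i.+1 + T (p - i.+1)%N).
    by rewrite mulr_sumr -big_split/=; apply: eq_bigr => i _; ring.
  by ring.
apply: le_trans (ler_normD _ _) _.
rewrite /exponent_norm mulrDl; apply: lerD.
  by rewrite normrM ler_wpM2l.
apply: le_trans (ler_norm_sum _ _ _) _.
rewrite -mulrA mulr_suml mulr_sumr; apply: ler_sum => i _.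
rewrite normrM mulrCA ler_wpM2l//.
have [_ h1] := H _ (ip i); have [_ h2] := H _ (ip' i).
by apply: le_trans (ler_normD _ _) _; lra.
Qed.

End EtaLog.

(** * Modularity bounds the growth at the cusps *)
Section CuspGrowth.
Set Implicit Arguments.
Unset Strict Implicit.
Variable R : realType.
Local Open Scope complex_scope.
Import Normc.

Lemma normc_sum (s : nat) (F : nat -> R[i]) :
  normc (\sum_(i < s) F i) <= \sum_(i < s) normc (F i).
Proof.
elim: s => [|s IH]; first by rewrite !big_ord0 normc0.
by rewrite !big_ord_recr/=; apply: le_trans (le_normcD _ _) _; rewrite lerD2r.
Qed.

(** The terms of the expansion are bounded at height [1], hence dominated by a
    geometric series at every height [t >= 2]. *)
Lemma holomorphic_at_infinity_bounded (N : nat) (f : cplx R -> cplx R) (x : R) :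
  (0 < N)%N -> holomorphic_at_infinity N f ->
  exists K : R, forall t : R, 2 <= t -> normc (f (x +i* t)) <= K.
Proof.
move=> N0 [c Hc].
pose rho : R := expR (- (2 * pi * N%:R^-1)).
have N0' : 0 < N%:R :> R by rewrite ltr0n.
have rho1 : rho < 1.
  by rewrite -subr_gt0 one_sub_expRN_gt0// !mulr_gt0 ?pi_gt0 ?invr_gt0.
have rho0 : 0 < rho by exact: expR_gt0.
have qn (t : R) n : normc (qpow N%:R^-1 (x +i* t) ^+ n) = expR (- (2 * pi * N%:R^-1 * t)) ^+ n.
  by rewrite normcX normc_qpow.
have [K0 HK0] : exists K0 : R, forall n, normc (c n) * rho ^+ n <= K0.
  have U1 : upper_half_plane (x +i* 1) by rewrite /upper_half_plane/=.
  have := cvgP _ (Hc _ U1) => /cvg_series_cvg_0 /cvg_normc /cvgP /cvg_seq_bounded.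
  move=> /bounded_fun_has_ubound [K0 HK]; exists K0 => n.
  have := HK (normc (c n * qpow N%:R^-1 (x +i* 1) ^+ n)).
  by rewrite normcM qn mulr1; apply; exists n => //; rewrite normcM qn mulr1.
have K00 : 0 <= K0.
  by apply: le_trans (HK0 0); rewrite mulr_ge0 ?normc_ge0 ?exprn_ge0 ?ltW.
exists (K0 / (1 - rho)) => t t2.
have Ut : upper_half_plane (x +i* t) by rewrite /upper_half_plane/= (lt_le_trans _ t2).
apply: (ler_cvg_to (cvg_normc (Hc _ Ut)) (cvg_cst _)).
near=> n; rewrite /series/= big_mkord.
apply: le_trans (@normc_sum n (fun j => c j * qpow N%:R^-1 (x +i* t) ^+ j)) _.
have ht : expR (- (2 * pi * N%:R^-1 * t)) <= rho * rho.
  have a0 : 0 < 2 * pi * N%:R^-1 :> R by rewrite !mulr_gt0 ?pi_gt0 ?invr_gt0.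
  by rewrite /rho -expRD ler_expR; nra.
apply: (@le_trans _ _ (\sum_(j < n) K0 * rho ^+ j)).
  apply: ler_sum => j _; rewrite normcM qn.
  apply: (@le_trans _ _ (normc (c j) * (rho ^+ j * rho ^+ j))); last first.
    by rewrite mulrA ler_wpM2r// exprn_ge0// ltW.
  rewrite ler_wpM2l ?normc_ge0// -exprMn; apply: lerXn2r => //.
  - exact: expR_ge0.
  - by rewrite nnegrE mulr_ge0 ?ltW.
rewrite -mulr_sumr ler_wpM2l//.
rewrite -[leRHS]div1r ler_pdivlMr ?subr_gt0// mulrC -opprB mulNr -subrX1 opprB.
by rewrite gerBl exprn_ge0// ltW.
Unshelve. all: by end_near. Qed.

Lemma det_mx22 (S : comPzRingType) (g : 'M[S]_2) :
  \det g = g 0 0 * g 1 1 - g 0 1 * g 1 0.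
Proof.
rewrite (expand_det_row _ 0) !big_ord_recl big_ord0 addr0 /cofactor !det_mx11 !mxE /=.
rewrite expr0 mul1r expr1 mulN1r mulrN.
by congr (_ * _ - _ * _); congr (g _ _); apply/val_inj.
Qed.

Lemma automorphy_vertical_line (g : 'M[int]_2) (t : R) : 0 < g 1%R 0%R ->
  let c : R := (g 1%R 0%R)%:~R in
  automorphy g ((- ((g 1%R 1%R)%:~R / c)) +i* t) = 0 +i* (c * t).
Proof.
move=> c0 c.
have cn0 : c != 0 by rewrite gt_eqF// ltr0z.
have cE : (g 1%R 0%R)%:~R = c%:C :> R[i] by rewrite rmorph_int.
have dE : (g 1%R 1%R)%:~R = ((g 1%R 1%R)%:~R : R)%:C :> R[i] by rewrite rmorph_int.
rewrite /automorphy cE dE.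
change ((c%:C * ((- ((g 1%R 1%R)%:~R / c)) +i* t) + ((g 1%R 1%R)%:~R : R)%:C : R[i]) = 0 +i* (c * t)).
by simpc; congr (_ +i* _); field.
Qed.

Lemma moebius_vertical_line (g : 'M[int]_2) (t : R) : SL2Z g -> 0 < g 1%R 0%R -> 0 < t ->
  let c : R := (g 1%R 0%R)%:~R in
  moebius g ((- ((g 1%R 1%R)%:~R / c)) +i* t) = ((g 0%R 0%R)%:~R / c) +i* (c ^+ 2 * t)^-1.
Proof.
move=> detg c0 t0 c.
have c0' : 0 < c by rewrite ltr0z.
have cn0 : c != 0 by rewrite gt_eqF.
have inj (z : int) : z%:~R = (z%:~R : R)%:C :> R[i] by rewrite rmorph_int.
have det : (g 0%R 0%R)%:~R * (g 1%R 1%R)%:~R - (g 0%R 1%R)%:~R * c = 1 :> R.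
  by have := congr1 (fun z : int => z%:~R : R) detg; rewrite det_mx22 rmorphB !rmorphM.
rewrite /moebius automorphy_vertical_line// -/c !inj.
have A0 : (0 +i* (c * t) : R[i]) != 0 by rewrite eq_complex/= eqxx/= gt_eqF// mulr_gt0.
apply: (mulIf (A0 : (0 +i* (c * t) : cplx R) != 0)); rewrite divfK//.
set al : R := (g 0%R 0%R)%:~R in det *; set be : R := (g 0%R 1%R)%:~R in det *.
set d : R := (g 1%R 1%R)%:~R in det *.
change ((al%:C * ((- (d / c)) +i* t) + be%:C : R[i]) = (al / c +i* (c ^+ 2 * t)^-1) * (0 +i* (c * t))).
have beE : be = (al * d - 1) / c by rewrite -det; field.
rewrite beE; simpc; congr (_ +i* _); field; rewrite ?cn0 ?gt_eqF//.
Qed.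

(** With [a, b, c, d] the entries of [g], the vertical line above [- d / c] is
    mapped to the one above [a / c], the height [t] becoming [1 / (c^2 t)], and
    the automorphy factor there is [i c t]. *)
Lemma cusp_growth (f : cplx R -> cplx R) (N : nat) (k : int) (g : 'M[int]_2) :
  (0 < N)%N -> SL2Z g -> 0 < g 1%R 0%R -> holomorphic_at_infinity N (slash k g f) ->
  let c : R := (g 1%R 0%R)%:~R in
  exists2 K : R, 0 < K &
  forall t, 2 <= t ->
    normc (f (((g 0%R 0%R)%:~R / c) +i* (c ^+ 2 * t)^-1)) <= K * t ^ k.
Proof.
move=> N0 detg c0 hol c.
have c0' : 0 < c by rewrite ltr0z.
have [K HK] := holomorphic_at_infinity_bounded (- ((g 1%R 1%R)%:~R / c)) N0 hol.
exists (`|K| * c ^ k + 1); first by rewrite ltr_wpDl// mulr_ge0// exprz_ge0// ltW.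
move=> t t2; have t0 : 0 < t by lra.
have := HK t t2; rewrite /slash automorphy_vertical_line// moebius_vertical_line// -/c.
set F := normc (f _); rewrite normcM normcXz -/F.
have -> : normc (0 +i* (c * t)) = c * t.
  by rewrite /= expr0n add0r sqrtr_sqr ger0_norm// mulr_ge0// ltW.
have ct0 : 0 < (c * t) ^ k by rewrite exprz_gt0// mulr_gt0.
rewrite -invr_expz ler_pdivrMl// => FK.
apply: le_trans FK _; rewrite mulrDl expfzMl.
have tk0 : 0 < t ^ k by rewrite exprz_gt0.
have ck0 : 0 < c ^ k by rewrite exprz_gt0.
have := ler_wpM2l (ltW (mulr_gt0 ck0 tk0)) (ler_norm K); lra.
Qed.

(** By [eta_product_log], [ln |f|] is [- S / (p u) + O(1 / (M u) + M)] at
    height [y = u / (2 pi)], while polynomial growth allows only [O(ln (1 / u))]. *)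
Lemma cusp_sum_ge_of_growth (p l M : nat) (a0 k : int) (a : {ffun 'I_(p.-1)./2 -> int})
    (C K : R) : (0 < p)%N -> (0 < M)%N -> 0 < C -> 0 < K ->
  (forall t : R, 2 <= t ->
    normc (eta_product a0 a ((l%:R / p%:R) +i* (C * t)^-1)) <= K * t ^ k) ->
  - (p%:R * exponent_norm R a0 a / M%:R) <=
    cusp_sum R a0 a l M.
Proof.
move=> p0 M0 C0 K0 growth; set S := cusp_sum R a0 a l M; set B := exponent_norm R a0 a.
have p0' : 0 < p%:R :> R by rewrite ltr0n.
have M0' : 0 < M%:R :> R by rewrite ltr0n.
have pi0 := pi_gt0 R.
have aux (x1 x2 X v w : R) : 0 <= x1 -> 0 <= x2 -> v * w <= X -> v <= X ->
    v * (x1 + 2 * x2 * w) <= (x1 + 2 * x2) * X.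
  by move=> h1 h2 h3 h4; have := ler_wpM2l h1 h4; have := ler_wpM2l h2 h3; lra.
have B0 : 0 <= B by rewrite /B /exponent_norm addr_ge0// mulr_ge0// sumr_ge0.
suff H : - (p%:R^-1 * S) <= B / M%:R.
  have := ler_wpM2l (ltW p0') H; rewrite mulrN mulVKf ?gt_eqF// mulrA; lra.
pose kappa := 2 * pi / C.
have kappa0 : 0 < kappa by rewrite divr_gt0// mulr_gt0.
set L := ell R a0 a.
apply: (@le_of_le_add_inv _ _ _
  (kappa * (`|ln K| + 2 * `|k%:~R| + kappa * `|L| + B * M%:R))) => n.
(* Along squares [t = s^2] the logarithm [ln t <= 2 s] is beaten by [u ~ 1 / t]. *)
set s : R := n.+2%:R; pose t := s ^+ 2.
have s2 : 2 <= s by rewrite /s ler_nat.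
have s0 : 0 < s by lra.
have t2 : 2 <= t by rewrite /t expr2; nra.
have t0 : 0 < t by lra.
have y0 : 0 < (C * t)^-1 by rewrite invr_gt0 mulr_gt0.
have [N0] := eta_product_log l a0 a p0 y0 M0.
have := growth t t2; set N := normc _ => NK.
set u := 2 * pi * _; rewrite -/S -/B -/L ler_norml => /andP[lo _].
have uE : u = kappa / t by rewrite /u /kappa invfM; field; rewrite !gt_eqF.
have u0 : 0 < u by rewrite uE divr_gt0.
have lnN : ln N <= `|ln K| + 2 * `|k%:~R| * s.
  have : ln N <= ln (K * t ^ k) by rewrite ler_ln ?posrE ?mulr_gt0 ?exprz_gt0.
  rewrite lnM ?posrE ?exprz_gt0// ln_exprz// => /le_trans; apply.
  apply: lerD; first exact: ler_norm.
  have lnt0 : 0 <= ln t by rewrite ln_ge0//; lra.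
  apply: le_trans (_ : `|k%:~R| * ln t <= _); first by rewrite ler_wpM2r// ler_norm.
  rewrite [2 * _]mulrC -mulrA ler_wpM2l//.
  have := ln_sublinear s0; rewrite /t lnXn// -mulr_natl; lra.
have us : u * s <= kappa / n.+1%:R.
  have -> : u * s = kappa / s by rewrite uE /t; field; rewrite gt_eqF.
  by rewrite ler_pM2l// lef_pV2 ?posrE ?ltr0n// ler_nat.
have us1 : u <= kappa / n.+1%:R by apply: le_trans us; rewrite ler_peMr ?(ltW u0)//; lra.
have uu : u ^+ 2 <= kappa * (kappa / n.+1%:R).
  have uk : u <= kappa by rewrite uE ler_piMr ?(ltW kappa0)// invf_le1//; lra.
  by rewrite expr2; apply: ler_pM => //; exact: ltW.
have h1 : u * ln N <= (`|ln K| + 2 * `|k%:~R|) * (kappa / n.+1%:R).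
  apply: le_trans (ler_wpM2l (ltW u0) lnN) _.
  exact: aux.
have h2 : u ^+ 2 * L <= kappa * `|L| * (kappa / n.+1%:R).
  apply: le_trans (_ : u ^+ 2 * `|L| <= _); first by rewrite ler_wpM2l ?sqr_ge0 ?ler_norm.
  by rewrite [leRHS]mulrAC ler_wpM2r.
have h3 : B * (u * M%:R) <= B * M%:R * (kappa / n.+1%:R).
  rewrite -[leRHS]mulrA [M%:R * (kappa / _)]mulrC; apply: ler_wpM2l => //.
  by apply: ler_wpM2r => //; exact: ltW.
move: lo h1 h2 h3; rewrite [B * (_ + _)]mulrDr [kappa * _ / _]mulrAC.
move: (u * ln N) (u ^+ 2 * L) (p%:R^-1 * S) (B * (u * M%:R)) (B / M%:R) (kappa / _).
move: `|ln K| `|k%:~R| `|L| (B * M%:R) kappa {kappa0 uE us us1 uu} => *; lra.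
Qed.

End CuspGrowth.

(** * Fourier analysis of the exponents *)
Section ExponentTransform.
Set Implicit Arguments.
Unset Strict Implicit.
Variable R : realType.
Local Open Scope complex_scope.

Lemma cosp_periodic (p n k : nat) : (0 < p)%N -> cosp R p (n + p * k) = cosp R p n.
Proof.
move=> p0; rewrite (@cosp_reflect R p (n + p * k) (p * n.+1 - n) (n.+1 + k))//; last first.
  have : (n <= p * n.+1)%N by rewrite (leq_trans (leqnSn n))// leq_pmull.
  by move=> h; rewrite mulnDr; lia.
rewrite (@cosp_reflect R p n (p * n.+1 - n) n.+1)//.
have : (n <= p * n.+1)%N by rewrite (leq_trans (leqnSn n))// leq_pmull.
by move=> h; lia.
Qed.

Lemma cosp_modn (p n : nat) : (0 < p)%N -> cosp R p n = cosp R p (n %% p).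
Proof. by move=> p0; rewrite {1}(divn_eq n p) addnC mulnC cosp_periodic. Qed.

Lemma cosp_neq1 (p n : nat) : (0 < p)%N -> ~~ (p %| n)%N -> cosp R p n != 1.
Proof.
move=> p0 pn; rewrite cosp_modn//.
have r0 : (0 < n %% p)%N by rewrite lt0n.
have rp : (n %% p < p)%N by rewrite ltn_mod.
move: (n %% p)%N r0 rp => r r0 rp; rewrite /cosp.
have -> : 2 * pi * (r%:R / p%:R) = (pi * (r%:R / p%:R)) *+ 2 :> R by rewrite mulr2n; ring.
rewrite cos_mulr2n.
have q0 : 0 < r%:R / p%:R :> R by rewrite divr_gt0 ?ltr0n.
have q1 : r%:R / p%:R < 1 :> R by rewrite ltr_pdivrMr ?ltr0n// mul1r ltr_nat.
set x := pi * _.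
have sx : 0 < sin x.
  apply: sin_gt0_pi; have := pi_gt0 R => pi0.
  by rewrite /x mulr_gt0//= -[ltRHS]mulr1 ltr_pM2l.
apply/eqP => c1; have := cos2Dsin2 x; nra.
Qed.

Lemma sum_cosp (p n : nat) : (0 < p)%N ->
  \sum_(l < p) cosp R p (l * n) = if (p %| n)%N then p%:R else 0.
Proof.
move=> p0; case: ifPn => [/dvdnP[k ->]|pn].
  under eq_bigr do rewrite mulnA mulnC cosp_mul//.
  by rewrite sumr_const card_ord.
pose z : R[i] := cis (2 * pi * (n%:R / p%:R)).
have zl (l : nat) : cosp R p (l * n) = complex.Re (z ^+ l).
  by rewrite /z cisX /= /cosp natrM; congr cos; ring.
under eq_bigr do rewrite zl.
rewrite -raddf_sum.
have -> : \sum_(l < p) z ^+ l = 0; last by [].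
have zp : z ^+ p = 1.
  rewrite /z cisX (_ : _ * _ = n%:R * (2 * pi)) ?cis_nat2pi//; field.
  by rewrite pnatr_eq0 gtn_eqF.
have z1 : z - 1 != 0.
  rewrite subr_eq0; apply: contraNneq (cosp_neq1 p0 pn) => z1.
  by have := zl 1%N; rewrite mul1n expr1 z1 => ->.
by apply: (mulfI z1); rewrite -subrX1 zp subrr mulr0.
Qed.

(** Product-to-sum formula; the difference of the angles is written with the
    complement [k] of [m] to stay in [nat]. *)
Lemma cosp_mul_cosp (p n m k : nat) : (0 < p)%N -> (m + k)%N = p ->
   forall l, 2 * (cosp R p (l * n) * cosp R p (l * m)) =
     cosp R p (l * (n + m)) + cosp R p (l * (n + k)).
Proof.
move=> p0 mk l.
have -> : cosp R p (l * (n + k)) = cos (2 * pi * ((l * n)%:R / p%:R) - 2 * pi * ((l * m)%:R / p%:R)).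
  rewrite -(cosp_periodic (l * (n + k)) 0 p0) muln0 addn0 /cosp -(cos_sub_nat2pi l) -cosN; congr cos.
  rewrite -mk !natrM !natrD; field; rewrite -natrD mk pnatr_eq0 gtn_eqF//.
rewrite /cosp.
have -> : 2 * pi * ((l * (n + m))%:R / p%:R) = 2 * pi * ((l * n)%:R / p%:R) + 2 * pi * ((l * m)%:R / p%:R) :> R.
  by rewrite mulnDr natrD; ring.
by rewrite !cosD cosN sinN; ring.
Qed.

End ExponentTransform.

(** * Nonnegative orders at the cusps bound the exponents *)
Section ExponentBound.
Set Implicit Arguments.
Unset Strict Implicit.
Variable R : realType.
Variables (p : nat) (a0 : int) (a : {ffun 'I_(p.-1)./2 -> int}).
Hypothesis pp : prime p.
Hypothesis a0_gt0 : 0 < a0.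
Let V n : R := exponent_transform R a0 a n.
Let p0 : (0 < p)%N := prime_gt0 pp.
Let p0' : 0 < p%:R :> R. Proof. by rewrite ltr0n. Qed.

Lemma double_index_lt (i : 'I_(p.-1)./2) : (i.+1 + i.+1 < p)%N.
Proof. have := ltn_ord i; lia. Qed.

Lemma exponent_transform_modn n : V n = V (n %% p).
Proof.
rewrite /V /exponent_transform; congr (_ + _ * _); apply: eq_bigr => i _; congr (_ * _).
by rewrite cosp_modn// [in RHS]cosp_modn// modnMml.
Qed.

(** If [p] does not divide [n], then [l * n] runs through all residues and only the
    coefficient at [0] survives. *)
Lemma sum_exponent_transform n :
  \sum_(l < p) V (l * n) = if (p %| n)%N then p%:R * V 0 else p%:R * a0%:~R.
Proof.
case: ifPn => pn.
  under eq_bigr do rewrite exponent_transform_modn (eqP (dvdn_mull _ pn)).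
  by rewrite sumr_const card_ord mulr_natl.
rewrite /V /exponent_transform big_split/= sumr_const card_ord -mulr_sumr.
rewrite exchange_big/= big1 ?mulr0 ?addr0 ?mulr_natl// => i _.
rewrite -mulr_sumr; under eq_bigr do rewrite -mulnA.
rewrite sum_cosp// Euclid_dvdM// (negPf pn)/= gtnNdvd ?mulr0//.
have := double_index_lt i; lia.
Qed.

Lemma exponent_inversion (j : 'I_(p.-1)./2) :
  \sum_(l < p) V l * cosp R p (l * j.+1) = p%:R * (a j)%:~R.
Proof.
rewrite /V /exponent_transform.
under eq_bigr do rewrite mulrDl -mulrA mulr_suml mulr_sumr.
have ndvd (k : nat) : (0 < k < p)%N -> (p %| k)%N = false.
  by move=> /andP[k0 kp]; rewrite gtnNdvd.
have jp := double_index_lt j.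
rewrite big_split/= -mulr_sumr sum_cosp// ndvd ?mulr0 ?add0r; last lia.
rewrite exchange_big/= (bigD1 j)//=.
have E (i : 'I_(p.-1)./2) :
   \sum_(l < p) 2 * ((a i)%:~R * cosp R p (l * i.+1) * cosp R p (l * j.+1)) =
   (a i)%:~R * (\sum_(l < p) cosp R p (l * (i.+1 + j.+1)) +
                \sum_(l < p) cosp R p (l * (i.+1 + (p - j.+1)))).
  rewrite -big_split mulr_sumr; apply: eq_bigr => l _ /=.
  rewrite -cosp_mul_cosp//; first ring.
  by rewrite subnKC//; lia.
rewrite E [X in _ + X]big1 ?addr0 => [|i ij].
  rewrite !sum_cosp// ndvd; last lia.
  by rewrite subnKC ?dvdnn ?add0r 1?mulrC//; lia.
have ip := double_index_lt i.
rewrite E !sum_cosp// ndvd; last lia.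
rewrite add0r; case: ifP => [|_]; last by rewrite mulr0.
move=> /dvdnP[[|[|k]] h].
- lia.
- by case/eqP: ij; apply/val_inj => /=; lia.
- by nia.
Qed.

Lemma sum_multiples (f : nat -> R) (M : nat) :
  \sum_(m < M | (p %| m.+1)%N) f m.+1 = \sum_(k < M %/ p) f (p * k.+1)%N.
Proof.
elim: M => [|M IH]; first by rewrite div0n !big_ord0.
rewrite big_mkcond big_ord_recr/= -big_mkcond IH divnS//.
case: ifPn => [pM|pM]; last by rewrite add0n addr0.
rewrite add1n big_ord_recr/=; congr (_ + f _).
have := divnS M p0; rewrite pM add1n => <-.
by rewrite mulnC divnK.
Qed.

Definition sum_inv_sqr M : R := \sum_(m < M) (m.+1%:R ^+ 2)^-1.

Lemma sum_inv_sqr_multiples_le M :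
  \sum_(m < M | (p %| m.+1)%N) (m.+1%:R ^+ 2)^-1 <= (p%:R ^+ 2)^-1 * sum_inv_sqr M.
Proof.
rewrite (sum_multiples (fun m => (m%:R ^+ 2)^-1)).
have -> : \sum_(k < M %/ p) ((p * k.+1)%:R ^+ 2)^-1 =
    (p%:R ^+ 2)^-1 * sum_inv_sqr (M %/ p).
  by rewrite mulr_sumr; apply: eq_bigr => k _; rewrite natrM exprMn invfM.
rewrite /sum_inv_sqr -[in leRHS](subnKC (leq_div M p)) big_split_ord/= mulrDr.
by rewrite lerDl mulr_ge0 ?invr_ge0 ?exprn_ge0 ?sumr_ge0// => i _; rewrite invr_ge0 exprn_ge0.
Qed.

(** The upper bound below [2] makes the first term of a sum weighted by
    [1 / m^2] dominate all the others together; [2 + n] terms make its two first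
    ones explicit. *)
Lemma sum_inv_sqr_bounds n : 1 <= sum_inv_sqr (2 + n) <= 7 / 4.
Proof.
rewrite /sum_inv_sqr big_split_ord/= !big_ord_recl big_ord0 addr0/=.
have := sum_inv_sqr_tail R n (isT : (0 < 2)%N).
have : 0 <= \sum_(i < n) ((2 + i).+1%:R ^+ 2)^-1 :> R.
  by apply: sumr_ge0 => i _; rewrite invr_ge0 exprn_ge0.
rewrite /bump/= addn0 expr1n invr1; set s := \sum_(_ < n) _.
have -> : (2 ^+ 2)^-1 = 1 / 4 :> R by rewrite expr2 -natrM div1r.
by move=> s0 s1; apply/andP; split; lra.
Qed.

Section FromLowerBounds.
(** In the limit of large [M], [E_ge] says that the orders at all the cusps [l / p]
    are nonnegative. *)
Variable B : R.
Hypothesis B0 : 0 <= B.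
Let E l M : R := cusp_sum R a0 a l M.
Hypothesis E_ge : forall l M, (l < p)%N -> (0 < M)%N -> - (B / M%:R) <= E l M.

Let A := V 0.
Let a0' : 0 < a0%:~R :> R. Proof. by rewrite ltr0z. Qed.
Let p2 : 2 <= p%:R :> R. Proof. by rewrite ler_nat prime_gt1. Qed.

Lemma cusp_sum0 M : E 0 M = A * sum_inv_sqr M.
Proof. by rewrite /E /cusp_sum /sum_inv_sqr mulr_sumr; apply: eq_bigr => m _; rewrite mul0n. Qed.

Let BM n : B / (2 + n)%:R <= B / n.+1%:R.
Proof. by rewrite ler_wpM2l// lef_pV2 ?posrE ?ltr0n// ler_nat. Qed.

Lemma exponent_transform0_ge0 : 0 <= A.
Proof.
rewrite -oppr_le0; apply: (@le_of_le_add_inv _ _ _ B) => n; rewrite add0r.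
have := @E_ge 0 (2 + n) p0 isT; rewrite cusp_sum0.
have /andP[s1 s2] := sum_inv_sqr_bounds n.
have Bn := BM n; have B1 : 0 <= B / n.+1%:R by rewrite divr_ge0.
move: (B / n.+1%:R) (B / (2+n)%:R) Bn B1 => x y xy x0 h.
by case: (leP 0 A) => A0; nra.
Qed.

(** The valence formula, as an inequality: summing over [l] replaces the transform
    by [p a0], except at the multiples of [p], whose total weight is at most a
    fraction [1 / p^2] of the whole. *)
Lemma sum_cusp_sum_le M : \sum_(l < p) E l M <= sum_inv_sqr M * (p%:R * a0%:~R + A / p%:R).
Proof.
rewrite /E /cusp_sum exchange_big/=.
have -> : \sum_(m < M) \sum_(l < p) V (l * m.+1) / m.+1%:R ^+ 2 =
   p%:R * a0%:~R * sum_inv_sqr M + p%:R * (A - a0%:~R) *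
      \sum_(m < M | (p %| m.+1)%N) (m.+1%:R ^+ 2)^-1.
  rewrite /sum_inv_sqr !mulr_sumr [X in _ = _ + X]big_mkcond -big_split/=.
  apply: eq_bigr => m _; rewrite -mulr_suml sum_exponent_transform -/A.
  by case: ifP => _; ring.
set D := \sum_(m < M | _) _.
have D0 : 0 <= D by apply: sumr_ge0 => i _; rewrite invr_ge0 exprn_ge0.
have DS : p%:R * D <= sum_inv_sqr M / p%:R.
  rewrite -ler_pdivlMl//; apply: le_trans (sum_inv_sqr_multiples_le M) _.
  by rewrite expr2 invfM -mulrA [_^-1 * sum_inv_sqr M]mulrC.
have h1 : 0 <= p%:R * a0%:~R * D by rewrite !mulr_ge0// ltW.
have h2 := ler_wpM2l exponent_transform0_ge0 DS.
lra.
Qed.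

(** A sum of nonnegative terms bounds each of them; here the terms are nonnegative
    up to [B / M]. *)
Lemma cusp_sum_le l n : (l < p)%N ->
  E l (2 + n) <= sum_inv_sqr (2 + n) * (p%:R * a0%:~R + A / p%:R) + p%:R * B / (2 + n)%:R.
Proof.
move=> lp; have := sum_cusp_sum_le (2 + n).
rewrite (bigD1 (Ordinal lp))//= => H.
suff : - (p%:R * B / (2 + n)%:R) <= \sum_(i < p | i != Ordinal lp) E i (2 + n) by lra.
apply: (@le_trans _ _ (\sum_(i < p | i != Ordinal lp) - (B / (2 + n)%:R))); last first.
  by apply: ler_sum => i _; exact: E_ge.
rewrite sumr_const mulNrn lerN2 -mulrA mulr_natl ler_wpMn2l ?divr_ge0//.
by rewrite -[leqRHS]card_ord; exact: max_card.
Qed.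

(** For [l = 0] both sides of [cusp_sum_le] are multiples of [sum_inv_sqr], in which
    [A] has coefficient [1] on the left and only [1 / p] on the right. *)
Lemma exponent_transform0_le : A <= 2 * p%:R * a0%:~R.
Proof.
suff : A * (1 - p%:R^-1) - p%:R * a0%:~R <= 0.
  have := exponent_transform0_ge0 => A0.
  have : p%:R^-1 <= 2^-1 :> R by rewrite lef_pV2 ?posrE.
  nra.
apply: (@le_of_le_add_inv _ _ _ (p%:R * B)) => n; rewrite add0r.
have := @cusp_sum_le 0 n p0; rewrite cusp_sum0 => H.
have /andP[s1 _] := sum_inv_sqr_bounds n.
have pB : p%:R * (B / (2 + n)%:R) <= p%:R * (B / n.+1%:R) by rewrite ler_wpM2l.
have pB0 : 0 <= p%:R * (B / n.+1%:R) by rewrite mulr_ge0 ?divr_ge0// ltW.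
set Y := A * _ - _.
have H' : sum_inv_sqr (2 + n) * Y <= p%:R * (B / n.+1%:R).
  apply: le_trans pB; rewrite mulrA /Y; lra.
rewrite -mulrA; case: (leP Y 0) => Y0; first exact: le_trans Y0 pB0.
by apply: le_trans H'; rewrite ler_peMl// ltW.
Qed.

(** Let [i] maximise [|V|]. In [cusp_sum] at [i] the term [V i] has weight [1] and
    the values of [V] in the other terms, at most [|V i|] in absolute value, have
    total weight at most [3 / 4]; so [|V i| <= 4 |cusp_sum|]. This replaces the
    nonvanishing of the Bernoulli numbers [B_(2, chi)] for even characters. *)
Lemma exponent_transform_le l : `|V l| <= 16 * p%:R * a0%:~R.
Proof.
pose i0 : 'I_p := Ordinal p0.
case: (@Order.TotalTheory.arg_maxP _ _ 'I_p i0 xpredT (fun i => `|V i|)) => //= i _ imax.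
have Vmax k : `|V k| <= `|V i|.
  by rewrite exponent_transform_modn; exact: (imax (Ordinal (ltn_pmod k p0))).
apply: le_trans (Vmax l) _.
apply: (@le_of_le_add_inv _ _ _ (4 * (p%:R * B))) => n.
have Ei : `|E i (2 + n)| <= 4 * p%:R * a0%:~R + p%:R * (B / n.+1%:R).
  have B1 : 0 <= B / n.+1%:R by rewrite divr_ge0.
  have Bp : B / n.+1%:R <= p%:R * (B / n.+1%:R) by rewrite ler_peMl//; have := p2; lra.
  have pa : 0 <= p%:R * a0%:~R :> R by rewrite mulr_ge0 ?ltW.
  rewrite ler_norml; apply/andP; split.
    apply: le_trans (E_ge (ltn_ord i) (isT : (0 < 2 + n)%N)).
    rewrite lerN2; apply: le_trans (BM n) _; apply: le_trans Bp _.
    by rewrite lerDr -mulrA mulr_ge0.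
  apply: le_trans (cusp_sum_le n (ltn_ord i)) _.
  have /andP[s1 s2] := sum_inv_sqr_bounds n.
  have pB : p%:R * (B / (2 + n)%:R) <= p%:R * (B / n.+1%:R) by rewrite ler_wpM2l// ltW.
  rewrite -mulrA; apply: lerD => //.
  have Ap : A / p%:R <= p%:R * a0%:~R.
    have := exponent_transform0_le; have := exponent_transform0_ge0 => A0 A1.
    have : A / p%:R <= A / 2 by rewrite ler_wpM2l// lef_pV2 ?posrE.
    lra.
  have Ap0 : 0 <= A / p%:R by rewrite divr_ge0 ?exponent_transform0_ge0// ltW.
  by nra.
have tail : `|E i (2 + n) - V i| <= 3 / 4 * `|V i|.
  have -> : E i (2 + n) - V i = \sum_(m < n.+1) V (i * m.+2) / m.+2%:R ^+ 2.
    by rewrite /E /cusp_sum big_ord_recl/= muln1 expr1n divr1 addrC addKr.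
  apply: le_trans (ler_norm_sum _ _ _) _.
  have /andP[_ s2] := sum_inv_sqr_bounds n.
  apply: (@le_trans _ _ (\sum_(m < n.+1) `|V i| * (m.+2%:R ^+ 2)^-1)).
    apply: ler_sum => m _; rewrite normrM ler_pM// ger0_norm ?invr_ge0 ?exprn_ge0//.
  rewrite -mulr_sumr mulrC ler_wpM2r//.
  by move: s2; rewrite /sum_inv_sqr big_ord_recl/= expr1n invr1; lra.
have : `|V i| <= `|E i (2 + n)| + `|E i (2 + n) - V i|.
  by rewrite -{1}(subKr (E i (2 + n)) (V i)) ler_normB.
have -> : 16 * p%:R * a0%:~R + 4 * (p%:R * B) / n.+1%:R =
    4 * (4 * p%:R * a0%:~R + p%:R * (B / n.+1%:R)) :> R by ring.
move: Ei tail; move: `|V i| `|E i (2 + n)| `|E i (2 + n) - V i| (_ + p%:R * _).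
by move=> v e d x; lra.
Qed.

(** By [exponent_inversion], [a j] is a mean of values of [V] weighted by cosines. *)
Lemma exponent_le j : `|a j| <= (16 * p)%N%:Z * a0.
Proof.
rewrite -(ler_int R) intr_norm rmorphM/= -pmulrn natrM -(ler_pM2l p0').
rewrite -[X in X * `|_|](gtr0_norm p0') -normrM -exponent_inversion.
apply: le_trans (ler_norm_sum _ _ _) _.
apply: (@le_trans _ _ (\sum_(l < p) 16 * p%:R * a0%:~R)); last first.
  by rewrite sumr_const card_ord [leRHS]mulr_natl.
apply: ler_sum => l _; rewrite normrM -[leRHS]mulr1 ler_pM//; first exact: exponent_transform_le.
by rewrite /cosp ler_norml cos_geN1 cos_le1.
Qed.

End FromLowerBounds.
End ExponentBound.

(** * Finiteness *)
Section Cusps.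
Set Implicit Arguments.
Unset Strict Implicit.
Variable R : realType.
Local Open Scope complex_scope.

Lemma exists_SL2Z_column (l c : nat) : (0 < c)%N -> coprime l c ->
  exists2 g, SL2Z g & g 0%R 0%R = l%:Z /\ g 1%R 0%R = c%:Z.
Proof.
move=> c0 lc; have [u [v uv]] := Bezoutz l c.
exists (\matrix_(i, j) (if i == 0 then if j == 0 then l%:Z else - v
                        else if j == 0 then c%:Z else u)); last by rewrite !mxE.
rewrite /SL2Z/= det_mx22 !mxE/= mulNr opprK mulrC uv.
by rewrite /gcdz/= (eqP lc).
Qed.

(** Holomorphy of the translates of [f] at infinity is used for one matrix sending
    infinity to [l / p] for each [l]: the bottom left entry is [p] when [l] is
    nonzero, and [1] when [l] is zero, where [l / p] is the cusp [0]. *)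
Lemma modular_form_cusp_sum_ge (p : nat) (a0 k : int) (a : {ffun 'I_(p.-1)./2 -> int}) :
  prime p -> modular_form p k (@eta_product R p a0 a) ->
  forall l M : nat, (l < p)%N -> (0 < M)%N ->
  - (p%:R * exponent_norm R a0 a / M%:R) <=
    cusp_sum R a0 a l M.
Proof.
move=> pp [_ _ hol] l M lp M0; have p0 := prime_gt0 pp.
have [l' [c [c0 lc lE]]] : exists l' c : nat, [/\ (0 < c)%N, coprime l' c &
    l'%:R / c%:R = l%:R / p%:R :> R].
  have [->|l0] := posnP l; first by exists 0, 1; rewrite !mul0r.
  by exists l, p; rewrite coprime_sym prime_coprime// gtnNdvd.
have [g detg [g00 g10]] := exists_SL2Z_column c0 lc.
have gc : 0 < g 1%R 0%R by rewrite g10.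
have [K K0 growth] := cusp_growth p0 detg gc (hol _ detg).
have C0 : 0 < (g 1%R 0%R)%:~R ^+ 2 :> R by rewrite exprn_gt0// ltr0z.
apply: (cusp_sum_ge_of_growth p0 M0 C0 K0) => t t2.
have := growth t t2; rewrite -lE g00 g10; exact.
Qed.

Lemma modular_form_exponent_le (p : nat) (a0 k : int) (a : {ffun 'I_(p.-1)./2 -> int}) :
  prime p -> 0 < a0 -> modular_form p k (@eta_product R p a0 a) ->
  forall j, `|a j| <= (16 * p)%N%:Z * a0.
Proof.
move=> pp a0_gt0 /(modular_form_cusp_sum_ge pp) H j.
apply: (@exponent_le R p a0 a pp a0_gt0 (p%:R * exponent_norm R a0 a)) => //.
by rewrite mulr_ge0// /exponent_norm addr_ge0// mulr_ge0// sumr_ge0.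
Qed.

Lemma finite_bounded_ffun (I : finType) (B : int) :
  finite_set [set a : {ffun I -> int} | forall i, `|a i| <= B].
Proof.
pose n := `|B|%N.
pose F (b : {ffun I -> 'I_(n + n).+1}) : {ffun I -> int} := [ffun i => (b i)%:Z - n%:Z].
apply: (@sub_finite_set _ _ (range F)); last exact: finite_image.
move=> a /= aB.
exists [ffun i => inord (absz (a i + n%:Z))] => //.
apply/ffunP => i; rewrite !ffunE.
have := aB i; rewrite ler_norml => /andP[lo hi].
have nB : n%:Z = B by rewrite /n; lia.
rewrite inordK; lia.
Qed.

End Cusps.

Theorem corollary2p3 (R : realType) (p : nat) (a0 : int) :
  prime p -> (5 <= p)%N -> 0 < a0 -> (2 %| a0)%Z ->
  finite_set [set a : {ffun 'I_(p.-1)./2 -> int} |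
    modular_form p (a0 %/ 2)%Z (@eta_product R p a0 a)].
Proof.
move=> pp _ a0_gt0 _.
apply: sub_finite_set (finite_bounded_ffun _ ((16 * p)%N%:Z * a0)) => a /= fa j.
exact: modular_form_exponent_le fa j.
Qed.
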